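(* Let $G$ be a locally reasonable metric group. Let $\mathcal K$ be a compact subset of $G$, let $R>0$, $0<\varepsilon<R$, $K\ge1$, and let $A\subseteq\mathcal K$ be non-empty. Then the following three statements are equivalent, in the sense that if one of them holds for one choice of implied constants in the $O()$, $\lesssim$, $\sim$ notation, then the others hold for some (possibly different) choice of implied constants: (i) $\mathcal N_\varepsilon(A^3)\lesssim_{\mathcal K,R,G}K^{O(1)}\mathcal N_\varepsilon(A)$. (ii) For all $n\ge1$ and all signs $\epsilon_1,\dots,\epsilon_n\in\{-1,1\}$, $\mathcal N_\varepsilon(A^{\epsilon_1}\cdots A^{\epsilon_n})\sim_{\mathcal K,R,G,n}K^{O_n(1)}\mathcal N_\varepsilon(A)$. (iii) There exists an $O_{\mathcal K,R,G}(K^{O(1)})$-approximate group $H$ with $\mathcal N_\varepsilon(H)\sim_{\mathcal K,R,G}K^{O(1)}\mathcal N_\varepsilon(A)$, which contains $A$ and is contained in a compact set $\tilde{\mathcal K}=\tilde{\mathcal K}(\mathcal K,R)$ depending only on $\mathcal K$ and $R$.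
   Context: A multiplicative group is a topological group $G$ with a non-negative Radon measure $\mu$ invariant under left and right translation and inversion, with every non-empty open set of positive measure; a multiplicative set is a non-empty open precompact subset. A multiplicative set $H$ is an $L$-approximate group if $H^{-1}=H$ and there is a finite symmetric $X\subseteq H\cdot H$ with $|X|\le L$ and $H\cdot H\subseteq X\cdot H$. A multiplicative group with metric $d_G$ is a locally reasonable metric group if: (a) the metric balls generate the topology and all closed balls are compact; (b) for every compact $\mathcal K\subseteq G$ there is $C$ with $C^{-1}d_G(x,y)\le d_G(gx,gy),d_G(xg,yg),d_G(x^{-1},y^{-1})\le Cd_G(x,y)$ for all $x,y,g\in\mathcal K$; (c) for every $R>0$ there is $C_R$ with $\mu(\mathbf B(1,2r))\le C_R\,\mu(\mathbf B(1,r))$ for all $0<r<R$, where $\mathbf B(x,r)$ is the open ball of radius $r$ about $x$. The metric entropy $\mathcal N_\varepsilon(X)$ is the least number of open balls of radius $\varepsilon$ needed to cover $X$. $A^{+1}=A$, $A^{-1}$ the set of inverses, products are setwise. Notation: $X\lesssim_{\mathcal K,R,G}K^{O(1)}Y$ means $X\le CK^{C}Y$ with $C$ depending only on $\mathcal K,R,G$ (additional subscripts such as $n$ allow dependence on them too); $\sim$ means the two-sided version $C^{-1}K^{-C}Y\le X\le CK^CY$; $O_{\mathcal K,R,G}(K^{O(1)})$ is a quantity at most such $CK^C$. *)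

(* Defs.v *)
From HB Require Import structures.
From mathcomp Require Import all_boot all_order all_algebra finmap.
From mathcomp Require Import all_classical all_reals all_analysis.

Set Implicit Arguments.
Unset Strict Implicit.
Unset Printing Implicit Defensive.

Import Order.TTheory GRing.Theory Num.Theory.
Import numFieldNormedType.Exports.

Local Open Scope classical_set_scope.
Local Open Scope ring_scope.

HB.mixin Record isTopologicalGroup G & Topological G & Group G := {
  mulg_continuous : continuous (fun xy : G * G => (xy.1 * xy.2)%g) ;
  invg_continuous : continuous (fun x : G => (x^-1)%g)
}.

(* A topological group together with a metric; [metricType] already requires
   the open metric balls to generate the topology. *)
#[short(type="metricGroupType")]
HB.structure Definition MetricGroup (R : realType) :=
  { G of Metric R G & Group G & isTopologicalGroup G }.

Section product_sets.
Context {R : realType} {G : metricGroupType R}.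
Implicit Types A B : set G.

Definition setmulg A B : set G := [set (a * b)%g | a in A & b in B].

Definition setinvg A : set G := [set (a^-1)%g | a in A].

(* As in [(-1) ^+ b], the sign -1 is encoded by [true] and +1 by [false]. *)
Definition setsigng (b : bool) A : set G := if b then setinvg A else A.

Definition signed_product n (s : 'I_n -> bool) A : set G :=
  \big[setmulg/[set 1%g]]_(i < n) setsigng (s i) A.

End product_sets.

(* The measurable types of the library are pointed: take 1 as the point. *)
Definition pointed_carrier (R : realType) (G : metricGroupType R) : Type := G.

HB.instance Definition _ (R : realType) (G : metricGroupType R) :=
  Choice.on (pointed_carrier G).
HB.instance Definition _ (R : realType) (G : metricGroupType R) :=
  isPointed.Build (pointed_carrier G) (1%g : G).

Notation borel G :=
  (g_sigma_algebraType (@open G : set (set (pointed_carrier G)))).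

Section multiplicative_groups.
Context {R : realType} {G : metricGroupType R}.
Variable mu : {measure set (borel G) -> \bar R}.

Record radon_measure : Prop := {
  radon_compact : forall E : set G, compact E -> (mu E < +oo)%E ;
  radon_outer : forall E : set (borel G), measurable E ->
    mu E = ereal_inf [set mu U | U in [set U : set G | open U /\ E `<=` U]] ;
  radon_inner : forall U : set G, open U ->
    mu U = ereal_sup [set mu E | E in [set E : set G | compact E /\ E `<=` U]]
}.

Record multiplicative_group : Prop := {
  multg_radon : radon_measure ;
  multg_mull : forall (g : G) (E : set (borel G)), measurable E ->
    mu (setmulg [set g] E) = mu E ;
  multg_mulr : forall (g : G) (E : set (borel G)), measurable E ->
    mu (setmulg E [set g]) = mu E ;
  multg_inv : forall E : set (borel G), measurable E -> mu (setinvg E) = mu E ;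
  multg_open : forall U : set G, open U -> U !=set0 -> (0 < mu U)%E
}.

Record locally_reasonable_metric_group : Prop := {
  lr_multiplicative : multiplicative_group ;
  lr_closed_ball : forall (x : G) (r : R), compact [set y | mdist x y <= r] ;
  lr_lipschitz : forall E : set G, compact E ->
    exists2 C : R, 0 < C & forall x y g, E x -> E y -> E g ->
      [/\ C^-1 * mdist x y <= mdist (g * x)%g (g * y)%g <= C * mdist x y,
          C^-1 * mdist x y <= mdist (x * g)%g (y * g)%g <= C * mdist x y &
          C^-1 * mdist x y <= mdist (x^-1)%g (y^-1)%g <= C * mdist x y] ;
  lr_doubling : forall rho : R, 0 < rho -> exists C : R, forall r : R,
    0 < r < rho -> (mu (ball (1%g : G) (2 * r)) <= C%:E * mu (ball (1%g : G) r))%E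
}.

End multiplicative_groups.

Section approximate_groups_and_entropy.
Context {R : realType} {G : metricGroupType R}.
Implicit Types A H X : set G.

Definition multiplicative_set H : Prop := [/\ H !=set0, open H & precompact H].

Definition approximate_group (L : R) H : Prop :=
  [/\ multiplicative_set H, setinvg H = H &
      exists X : {fset G},
        [/\ setinvg [set` X] = [set` X], [set` X] `<=` setmulg H H,
            (#|` X|)%:R <= L &
            setmulg H H `<=` setmulg [set` X] H]].

(* The centres range over all of [G]; the value is [+oo] when no finite family
   of balls covers [X]. *)
Definition metric_entropy (eps : R) X : \bar R :=
  ereal_inf [set (size s)%:R%:E |
    s in [set s : seq G | X `<=` \bigcup_(c in [set` s]) ball c eps]].

End approximate_groups_and_entropy.

(* [X <~ K^O(1) Y] and [X ~ K^O(1) Y] with the implied constant [C], which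
   serves both as factor and as exponent. *)
Section implied_constants.
Context {R : realType}.
Implicit Types (C K : R) (X Y : \bar R).

Definition poly_lesssim C K X Y : Prop := (X <= (C * K `^ C)%:E * Y)%E.

Definition poly_sim C K X Y : Prop :=
  ((C^-1 * K `^ (- C))%:E * Y <= X <= (C * K `^ C)%:E * Y)%E.

End implied_constants.

Section equivalent_statements.
Context {R : realType} {G : metricGroupType R}.
Implicit Types (eps K : R) (A Kt : set G).

Definition small_tripling (C : {posnum R}) eps K A : Prop :=
  poly_lesssim C%:num K (metric_entropy eps (setmulg (setmulg A A) A))
    (metric_entropy eps A).

(* The implied constant may depend on the length [n] of the product. *)
Definition small_products (C : nat -> {posnum R}) eps K A : Prop :=
  forall n, (1 <= n)%N -> forall s : 'I_n -> bool,
    poly_sim (C n)%:num K (metric_entropy eps (signed_product s A))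
      (metric_entropy eps A).

Definition approximate_group_control Kt (C : {posnum R}) eps K A : Prop :=
  exists H : set G,
    [/\ approximate_group (C%:num * K `^ C%:num) H,
        poly_sim C%:num K (metric_entropy eps H) (metric_entropy eps A),
        A `<=` H & H `<=` Kt].

(* If [P] holds with implied constants [c], then [Q] holds with implied
   constants [c'] depending on [c], [G], [Kc] and [rho], but not on the
   scale [eps], on [K] or on [A]. *)
Definition uniformly_implies (Kc : set G) (rho : R) (I J : Type)
    (P : I -> R -> R -> set G -> Prop) (Q : J -> R -> R -> set G -> Prop) :
    Prop :=
  forall c : I, exists c' : J, forall eps K A,
    0 < eps < rho -> 1 <= K -> A `<=` Kc -> A !=set0 ->
    P c eps K A -> Q c' eps K A.

End equivalent_statements.

(* Main.v *)
Require Import Defs.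
From HB Require Import structures.
From mathcomp Require Import all_boot all_order all_algebra finmap.
From mathcomp Require Import all_classical all_reals all_analysis.
From mathcomp Require Import ring lra.

Set Implicit Arguments.
Unset Strict Implicit.
Unset Printing Implicit Defensive.

Import Order.TTheory GRing.Theory Num.Theory.
Import numFieldNormedType.Exports.

Local Open Scope classical_set_scope.
Local Open Scope ring_scope.

(* Doubling of Haar measure at small scales bounds the number of [lam eps]-
   separated points in a ball of radius [nu eps], so on bounded sets covering
   and packing numbers at comparable scales agree up to constants.  Since the
   group operations are Lipschitz there, this gives Ruzsa's inequality
   [N(P S) N(Q) <= M N(P Q^-1) N(Q S)].  Put [T = A `|` A^-1 `|` 1].  Starting
   from [A^3], choices of [Q] in [A, A^-1] control [A A^-1], [A A A^-1], then
   [T^3], and finally every [T^n] through [T^(n+1) = T^2 T^(n-1)].  If [V] is a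
   symmetric [eps]-neighbourhood of [T], then [V V] is an approximate group:
   take a maximal family of disjoint translates [x V] with [x] in [V^4], whose
   size is bounded by comparing the entropies of [V^5] and [A].  Conversely,
   [H^(n+1)] is covered by [|X|] translates of [H^n]. *)

(** * Bounded sets *)

Section bounded_sets.
Context {R : realType} {G : metricGroupType R}.
Implicit Types (x y g : G) (r : R) (E : set G).

(** The metric is not assumed invariant: translation and inversion distort distances by a factor
    that depends on how far out the points lie. Every set is therefore confined to a closed ball
    about 1 whose radius is fixed before [eps] and [A], and the Lipschitz constants are those of
    such a ball. Each distortion also changes the scale, so points separated at [lam * eps] have to
    be compared with covers at [nu * eps] without any relation between [lam] and [nu]. The bound
    [rho] on the scale is present because doubling is uniform only below a given radius and because
    neighbourhoods must stay in a fixed ball. Tripling is the right starting point rather than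
    doubling: if [A] is a subgroup [H] with one further point [x], then [A A] has size comparable to
    [H], while [A A A] contains [H x H], which can be far larger. Ruzsa's inequality, on the other
    hand, passes from words of length three to words of every length. *)

Definition cball r : set G := [set y | mdist 1%g y <= r].

Lemma le_cball r r' : r <= r' -> cball r `<=` cball r'.
Proof. by move=> rr' x /= /le_trans; apply. Qed.

Lemma cball1 r : 0 <= r -> cball r 1%g.
Proof. by move=> r0; rewrite /cball /= mdistxx. Qed.

Lemma compact_sub_cball E : compact E -> exists r, E `<=` cball r.
Proof.
move=> /compact_near_coveringP cE.
have [n _ nE] : \forall n \near \oo, E `<=` (fun x => mdist 1%g x <= n%:R).
  apply: (cE nat \oo (fun n x => mdist 1%g x <= n%:R)) => x _.
  (* Near [x] the radius [mdist 1 x + 1] suffices; the near-covering form of compactness makes this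
     uniform along the filter at infinity. *)
  exists (ball x 1, [set n | mdist 1%g x + 1 <= n%:R]) => /=.
    by split; [exact: nbhsx_ballx|exact: nbhs_infty_ger].
  move=> [y n] /= [xy xn]; move: xy; rewrite ballEmdist /= => xy.
  have := metric_triangle 1%g x y; lra.
by exists n%:R; exact: (nE n (leqnn n)).
Qed.

End bounded_sets.

Section locally_reasonable.
Context {R : realType} {G : metricGroupType R}.
Context {mu : {measure set (borel G) -> \bar R}}.
Hypothesis hG : locally_reasonable_metric_group mu.

(** Only upper bounds are kept: a lower bound is recovered by applying the upper one to the inverse
    operation. *)
Lemma lipschitz_cball r : exists2 L : R, 1 <= L & forall x y g : G,
  cball r x -> cball r y -> cball r g ->
  [/\ mdist (g * x)%g (g * y)%g <= L * mdist x y,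
      mdist (x * g)%g (y * g)%g <= L * mdist x y &
      mdist (x^-1)%g (y^-1)%g <= L * mdist x y].
Proof.
have [C C0 CP] := lr_lipschitz hG (@lr_closed_ball _ _ _ hG 1%g r).
exists (Num.max 1 C); first by rewrite le_max lexx.
move=> x y g xr yr gr; have CC z w : C * mdist z w <= Num.max 1 C * mdist z w :> R.
  by rewrite ler_wpM2r ?mdist_ge0// le_max lexx orbT.
have [/andP[_ h1] /andP[_ h2] /andP[_ h3]] := CP x y g xr yr gr.
by split; [move: h1|move: h2|move: h3] => /le_trans; apply.
Qed.

(** Without invariance of the metric, the radius of a product is not bounded by the sum of the
    radii; [r'] comes from compactness of the images of the ball and of its square. *)
Lemma cball_hull r : exists2 r' : R, r <= r' & forall x y : G,
  cball r x -> cball r y -> cball r' (x * y)%g /\ cball r' (x^-1)%g.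
Proof.
have cE : compact (cball r : set G) := @lr_closed_ball _ _ _ hG 1%g r.
have [r1 h1] : exists r1, (fun x : G => (x^-1)%g) @` cball r `<=` cball r1.
  apply: compact_sub_cball; apply: continuous_compact => //.
  by apply: continuous_subspaceT => x; exact: invg_continuous.
have [r2 h2] : exists r2,
    (fun xy : G * G => (xy.1 * xy.2)%g) @` (cball r `*` cball r) `<=` cball r2.
  apply: compact_sub_cball; apply: continuous_compact; last exact: compact_setX.
  by apply: continuous_subspaceT => x; exact: mulg_continuous.
exists (Num.max r (Num.max r1 r2)); first by rewrite le_max lexx.
move=> x y xr yr; split.
  apply: (@le_cball _ _ r2); first by rewrite !le_max lexx !orbT.
  by apply: h2; exists (x, y).
apply: (@le_cball _ _ r1); first by rewrite !le_max lexx !orbT.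
by apply: h1; exists x.
Qed.

End locally_reasonable.

(** * Packing balls by doubling *)

Section packing.
Context {R : realType} {G : metricGroupType R}.

Definition separated_seq (d : R) (s : seq G) : Prop :=
  uniq s /\ {in s &, forall x y, mdist x y < d -> x = y}.

Context {mu : {measure set (borel G) -> \bar R}}.
Hypothesis hG : locally_reasonable_metric_group mu.

Lemma open_measurable_borel (U : set G) : open U -> measurable (U : set (borel G)).
Proof. by move=> oU; exact: sub_sigma_algebra. Qed.

Lemma open_ball_metric (x : G) r : open (ball x r).
Proof.
rewrite openE => y; rewrite ballEmdist /= => xy.
apply/nbhs_ballP; exists (r - mdist x y); first by rewrite /= subr_gt0.
move=> z; rewrite !ballEmdist /= => yz.
have := metric_triangle x y z; lra.
Qed.

Lemma le_measure_open (U V : set G) : open U -> open V -> U `<=` V ->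
  (mu U <= mu V)%E.
Proof.
move=> oU oV; apply: (@le_measure _ _ _ mu); rewrite inE;
  exact: open_measurable_borel.
Qed.

Lemma open_translate (g : G) (U : set G) : open U -> open (setmulg [set g] U).
Proof.
move=> oU; have -> : setmulg [set g] U = (fun z => (g^-1 * z)%g) @^-1` U.
  apply/seteqP; split=> [z [_ -> [u Uu <-]]|z /= Uz]; first by rewrite /= mulKg.
  by exists g => //; exists (g^-1 * z)%g => //; rewrite mulVKg.
apply: open_comp => // z _.
apply: (@continuous_comp _ _ _ (fun z => ((g^-1)%g, z))
  (fun xy : G * G => (xy.1 * xy.2)%g)); last exact: mulg_continuous.
by apply: cvg_pair => //; exact: cvg_cst.
Qed.

Lemma measure_ball_translate (r T : R) : exists2 L : R, 1 <= L &
  forall (x : G) t, cball r x -> 0 < t <= T ->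
    (mu (ball x t) <= mu (ball (1%g : G) (L * t)))%E /\
    (mu (ball (1%g : G) (t / L)) <= mu (ball x t))%E.
Proof.
have [r' rr' hr'] := cball_hull hG (`|r| + `|T|).
have [L L1 lip] := lipschitz_cball hG r'.
exists L => // x t xr /andP[t0 tT].
have L0 : 0 < L by apply: lt_le_trans L1.
have xR : cball (`|r| + `|T|) x.
  by apply: le_cball xr; rewrite ler_wpDr// ler_norm.
have R0 : 0 <= `|r| + `|T| by rewrite addr_ge0.
have sub : (cball (`|r| + `|T|) : set G) `<=` cball r' by apply: le_cball.
have inv1 := multg_mull (lr_multiplicative hG).
have tN : t <= `|T| by apply: le_trans tT _; exact: ler_norm.
split.
  rewrite -(inv1 x (ball 1%g (L * t))); last first.
    by apply: open_measurable_borel; exact: open_ball_metric.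
  apply: le_measure_open; first exact: open_ball_metric.
    by apply: open_translate; exact: open_ball_metric.
  move=> y; rewrite ballEmdist /= => xy.
  exists x => //; exists (x^-1 * y)%g; last by rewrite mulVKg.
  have yR : cball (`|r| + `|T|) y.
    have := metric_triangle 1%g x y; rewrite /cball /= in xr *.
    have := ler_norm r; lra.
  rewrite ballEmdist /=.
  have [] := lip x y (x^-1)%g (sub _ xR) (sub _ yR) (hr' _ _ xR xR).2.
  rewrite mulVg => h _ _; apply: le_lt_trans h _.
  by rewrite ltr_pM2l.
rewrite -(inv1 x (ball 1%g (t / L))); last first.
  by apply: open_measurable_borel; exact: open_ball_metric.
apply: le_measure_open; last 2 first.
- exact: open_ball_metric.
- move=> z [_ -> [y yb <-]]; move: yb; rewrite !ballEmdist /= => yb.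
  have yt : mdist 1%g y <= t.
    by apply: le_trans (ltW yb) _; rewrite ler_pdivrMr// ler_peMr// ltW.
  have yR : cball (`|r| + `|T|) y.
    rewrite /cball /=; have := normr_ge0 r; lra.
  have [] := lip 1%g y x (sub _ (cball1 R0)) (sub _ yR) (sub _ xR).
  rewrite mulg1 => h _ _; apply: le_lt_trans h _.
  by rewrite mulrC -ltr_pdivlMr.
- by apply: open_translate; exact: open_ball_metric.
Qed.

Lemma measure_ball_doubling (T lam : R) : exists C : R, forall t, 0 < t -> t < T ->
  (mu (ball (1%g : G) (lam * t)) <= C%:E * mu (ball (1%g : G) t))%E.
Proof.
(* Here [lam < k <= 2 ^ k], so [k] doublings reach the factor [lam]. *)
pose k := (Num.truncn lam).+1.
have [T0|T0] := leP T 0.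
  by exists 0 => t t0 tT; have := lt_trans t0 tT; rewrite ltNge T0.
have [C CP] : exists C : R, forall t, 0 < t -> t < T ->
    (mu (ball (1%g : G) (2 ^+ k * t)) <= C%:E * mu (ball (1%g : G) t))%E.
  elim: k => [|k [C CP]].
    by exists 1 => t _ _; rewrite expr0 mul1r mul1e.
  (* After [k] doublings the radius is still below [2 ^ k * T], which is the range requested from
     the doubling condition. *)
  have [D DP] := lr_doubling hG (mulr_gt0 (exprn_gt0 k (ltr0n R 2)) T0).
  exists (Num.max D 0 * C) => t t0 tT.
  rewrite exprS -mulrA (le_trans (DP _ _))//.
    by rewrite mulr_gt0 ?exprn_gt0//= ltr_pM2l ?exprn_gt0.
  rewrite EFinM -muleA.
  apply: (@le_trans _ _ ((Num.max D 0)%:E * mu (ball (1%g : G) (2 ^+ k * t)))%E).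
    by rewrite lee_wpmul2r// lee_fin le_max lexx.
  by rewrite lee_wpmul2l ?CP// lee_fin le_max lexx orbT.
exists C => t t0 tT; apply: le_trans (CP t t0 tT).
have k0 : 0 < 2 ^+ k * t by rewrite mulr_gt0 ?exprn_gt0.
have [l0|l0] := ltP 0 (lam * t); last first.
  have -> : ball (1%g : G) (lam * t) = set0.
    apply/seteqP; split=> // y; rewrite ballEmdist /= => h.
    by have := lt_le_trans h l0; rewrite ltNge mdist_ge0.
  by rewrite measure0.
apply: le_measure_open; try exact: open_ball_metric.
apply: le_ball; rewrite ler_pM2r//.
apply: le_trans (ltW (truncnS_gt lam)) _.
by rewrite -natrX ler_nat ltnW// ltn_expl.
Qed.

(** Measures of disjoint open sets add up. [V] is generalised because the induction is applied with
    the union of the remaining sets in its place. *)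
Lemma packing_measure (s : seq G) (F : G -> set G) (V : set G) (v : \bar R) :
  uniq s -> {in s, forall x, open (F x)} -> open V ->
  {in s, forall x, F x `<=` V} -> {in s, forall x, (v <= mu (F x))%E} ->
  {in s &, forall x y, F x `&` F y !=set0 -> x = y} ->
  ((size s)%:R%:E * v <= mu V)%E.
Proof.
elim: s V => [|x s IH] V /=; first by move=> *; rewrite mul0e.
move=> /andP[xs us] oF oV FV vF Fdis.
have sub y : y \in s -> y \in x :: s by move=> ys; rewrite inE ys orbT.
have h : ((size s)%:R%:E * v <= mu (\bigcup_(y in [set` s]) F y))%E.
  apply: IH => //.
  - by move=> y ys; apply: oF; exact: sub.
  - by apply: bigcup_open => y ys; apply: oF; exact: sub.
  - by move=> y ys; exact: bigcup_sup.
  - by move=> y ys; apply: vF; exact: sub.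
  - by move=> y z ys zs; apply: Fdis; exact: sub.
have oU : open (\bigcup_(y in [set` s]) F y).
  by apply: bigcup_open => y ys; apply: oF; exact: sub.
have oX : open (F x) by apply: oF; rewrite inE eqxx.
apply: (@le_trans _ _ (mu (F x `|` \bigcup_(y in [set` s]) F y))).
  rewrite (@measureU _ _ _ mu); try exact: open_measurable_borel.
    rewrite -natr1 EFinD addrC ge0_muleDl ?lee_fin// mul1e.
    by rewrite leeD// vF// inE eqxx.
  apply/seteqP; split=> // z [Fxz [y /= ys Fyz]].
  have xy : x = y.
    by apply: Fdis; [rewrite inE eqxx|exact: sub|exists z].
  by move: xs; rewrite xy ys.
apply: le_measure_open => //; first exact: openU.
by move=> z [Fxz|[y /= ys Fyz]]; [apply: (FV x) => //; rewrite inE eqxx|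
  apply: (FV y) => //; exact: sub].
Qed.

(** Volume comparison: the balls of radius [lam * eps / 2] about the points are disjoint and lie in
    one ball of radius [w * eps]; once both are moved to 1, doubling compares their measures. *)
Lemma packing_ball (r rho lam nu : R) : 0 < lam -> 0 < nu ->
  exists2 M : R, 0 < M & forall eps s c, 0 < eps < rho ->
    separated_seq (lam * eps) s -> {in s, forall x, cball r x} ->
    {in s, forall x, ball c (nu * eps) x} -> (size s)%:R <= M.
Proof.
move=> lam0 nu0.
(* The large ball is centred at a point [x0] of the sequence, since [c] need not lie in [cball r],
   where translation is controlled. Going from [x0] to another point through [c] costs [2 * nu]. *)
pose w := 2 * nu + lam.
have w0 : 0 < w by rewrite /w; lra.
have [L L1 LP] := measure_ball_translate r (w * rho).
have L0 : 0 < L by apply: lt_le_trans L1.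
have [C CP] := measure_ball_doubling (lam / (2 * L) * rho)
  (L * w / (lam / (2 * L))).
exists (Num.max C 1); first by rewrite lt_max ltr01 orbT.
move=> eps [|x0 s'] c; first by rewrite le_max ler01 orbT.
set s := x0 :: s'; move=> /andP[e0 er] [us sep] sr sc.
(* A common lower bound for the small balls; it is positive and finite, so it can be cancelled at
   the end. *)
pose v := mu (ball (1%g : G) (lam / (2 * L) * eps)).
have q0 : 0 < lam / (2 * L) by rewrite divr_gt0// mulr_gt0.
have le0 : 0 < lam * eps by rewrite mulr_gt0.
have ler : lam * eps / 2 <= w * rho.
  have : lam * eps < lam * rho by rewrite ltr_pM2l.
  have : 0 < nu * rho by rewrite mulr_gt0//; apply: lt_trans er.
  rewrite /w mulrDl -mulrA; lra.
have we : 0 < w * eps <= w * rho by rewrite mulr_gt0//= ler_pM2l// ltW.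
have x0s : x0 \in s by rewrite inE eqxx.
have v0 : (0 < v)%E.
  apply: (multg_open (lr_multiplicative hG)).
    by exact: open_ball_metric.
  by exists 1%g; apply: ballxx; rewrite mulr_gt0.
have vfin : (v < +oo)%E.
  have := radon_compact (multg_radon (lr_multiplicative hG))
    (@lr_closed_ball _ _ _ hG 1%g (lam / (2 * L) * eps)).
  apply: le_lt_trans; apply: (@le_measure _ _ _ mu); rewrite ?inE.
  - by apply: open_measurable_borel; exact: open_ball_metric.
  - rewrite -[X in measurable X]setCK; apply: measurableC.
    apply: open_measurable_borel; apply: closed_openC.
    apply: compact_closed; first exact: metric_hausdorff.
    exact: (@lr_closed_ball _ _ _ hG).
  - by rewrite ballEmdist => y /= /ltW.
have sv : ((size s)%:R%:E * v <= mu (ball x0 (w * eps)))%E.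
  apply: (@packing_measure s (fun x => ball x (lam * eps / 2))) => //.
  - by move=> x _; exact: open_ball_metric.
  - by exact: open_ball_metric.
  - move=> x xs y; have := sc x xs; have := sc x0 x0s.
    rewrite !ballEmdist /= => cx0 cx xy.
    have := metric_triangle x0 c x; rewrite (metric_sym x0 c).
    have := metric_triangle x0 x y; rewrite /w mulrDl -mulrA; lra.
  - move=> x xs.
    have le2 : 0 < lam * eps / 2 <= w * rho by rewrite divr_gt0.
    have [_] := LP x (lam * eps / 2) (sr x xs) le2.
    apply: le_trans; rewrite /v.
    have -> // : lam / (2 * L) * eps = lam * eps / 2 / L.
    by field; rewrite gt_eqF.
  - move=> x y xs ys [z []]; rewrite !ballEmdist /= => xz yz.
    apply: sep => //; have := metric_triangle x z y; rewrite (metric_sym z y); lra.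
have : ((size s)%:R%:E * v <= C%:E * v)%E.
  apply: le_trans sv _; have [h _] := LP x0 (w * eps) (sr x0 x0s) we.
  apply: le_trans h _.
  have -> : L * (w * eps) = L * w / (lam / (2 * L)) * (lam / (2 * L) * eps).
    by rewrite mulrA [RHS]mulrA divfK// gt_eqF.
  apply: CP; first by rewrite mulr_gt0.
  by rewrite ltr_pM2l.
rewrite lee_pmul2r//; last by rewrite ge0_fin_numE// ltW.
by rewrite lee_fin le_max => ->.
Qed.

End packing.

(** * Metric entropy and packing numbers *)

Section metric_entropy_theory.
Context {R : realType} {G : metricGroupType R}.
Implicit Types (X Y : set G) (s t : seq G) (eps r d M : R).

Definition covers (eps : R) s X : Prop :=
  X `<=` \bigcup_(c in [set` s]) ball c eps.

Definition entropy (eps : R) X : R := fine (metric_entropy eps X).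

Lemma covers_entropy eps s X : covers eps s X ->
  exists t, [/\ covers eps t X, (size t <= size s)%N &
    metric_entropy eps X = (size t)%:R%:E].
Proof.
move=> cs.
pose P n := `[< exists2 t, covers eps t X & size t = n >].
have exP : exists n, P n by exists (size s); apply/asboolP; exists s.
have [t ct szt] : exists2 t, covers eps t X & size t = ex_minn exP.
  by case: ex_minnP => m /asboolP.
case: ex_minnP szt => m _ minm szt; exists t; split=> //.
  by rewrite szt; apply: minm; apply/asboolP; exists s.
apply/eqP; rewrite eq_le; apply/andP; split.
  by apply: ereal_inf_lbound; exists t.
apply: le_ereal_inf_tmp => _ [u cu <-]; rewrite lee_fin ler_nat szt.
by apply: minm; apply/asboolP; exists u.
Qed.

Lemma entropy_le_size eps s X : covers eps s X -> entropy eps X <= (size s)%:R.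
Proof.
by move=> /covers_entropy [t [_ ts]]; rewrite /entropy => ->; rewrite /= ler_nat.
Qed.

(** The fibres may overlap, so the induction on [t] discards from [s] everything related to the head
    of [t] before continuing. *)
Lemma size_le_fibers (A B : eqType) (rel : B -> A -> bool) (s : seq A)
    (t : seq B) (M : R) :
  {in s, forall x, exists2 c, c \in t & rel c x} ->
  (forall c, c \in t -> (size [seq x <- s | rel c x])%:R <= M) ->
  (size s)%:R <= M * (size t)%:R.
Proof.
elim: t s => [|c t IH] s st sM.
  by case: s st {sM} => [|x s] st; [rewrite mulr0|
    have [] := st x (mem_head _ _)].
rewrite -(count_predC (rel c) s) natrD /= -natr1 mulrDr mulr1 addrC lerD//.
  rewrite -size_filter; apply: IH.
    move=> x; rewrite mem_filter /= => /andP[cx xs].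
    have [d] := st x xs; rewrite inE => /orP[/eqP ->|dt dx]; last by exists d.
    by rewrite (negbTE cx).
  move=> d dt; apply: le_trans (sM d _); last by rewrite inE dt orbT.
  rewrite ler_nat -filter_predI !size_filter.
  by apply: sub_count => x /= /andP[].
by rewrite -size_filter; apply: sM; rewrite mem_head.
Qed.

(** Serves both for separated sets and for disjoint translates. The bound [M] yields an independent
    sequence of maximal length, to which an element unrelated to all its members could still be
    added. *)
Lemma maximal_independent_seq (A : eqType) (rel : A -> A -> Prop) (X : set A) M :
  (forall x y, rel x y -> rel y x) -> (forall x, X x -> rel x x) ->
  (forall s : seq A, uniq s -> {in s &, forall x y, rel x y -> x = y} ->
    {in s, forall x, X x} -> (size s)%:R <= M) ->
  exists s : seq A, [/\ uniq s, {in s &, forall x y, rel x y -> x = y},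
    {in s, forall x, X x} & forall x, X x -> exists2 y, y \in s & rel y x].
Proof.
move=> rsym rrefl sM.
pose indep (s : seq A) := [/\ uniq s, {in s &, forall x y, rel x y -> x = y} &
  {in s, forall x, X x}].
pose P n := `[< exists s : seq A, indep s /\ size s = n >].
have exP : exists n, P n by exists 0%N; apply/asboolP; exists [::].
have ubP n : P n -> (n <= Num.truncn M)%N.
  move=> /asboolP[s [[us ss sX] <-]].
  by rewrite -(@natrK R (size s)) le_truncn ?sM.
have [s [[us ss sX] szs]] : exists s : seq A, indep s /\ size s = ex_maxn exP ubP.
  by case: ex_maxnP => m /asboolP.
exists s; split=> // x Xx; apply: contrapT => nx.
have far y : y \in s -> ~ rel y x by move=> ys yx; apply: nx; exists y.
case: ex_maxnP szs => m _ maxm szs.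
suff : P (size s).+1 by move=> /maxm; rewrite szs ltnn.
apply/asboolP; exists (x :: s); split=> //; split=> /=.
- by rewrite us andbT; apply/negP => /far; apply; exact: rrefl.
- move=> y z; rewrite !inE => /orP[/eqP ->|ys] /orP[/eqP ->|zs] //.
  + by move=> /rsym /(far _ zs).
  + by move=> /(far _ ys).
  + exact: ss.
- by move=> y; rewrite inE => /orP[/eqP ->//|]; exact: sX.
Qed.

Context {mu : {measure set (borel G) -> \bar R}}.
Hypothesis hG : locally_reasonable_metric_group mu.

Lemma maximal_separated_cball d r X : 0 < d -> X `<=` cball r ->
  exists s, [/\ separated_seq d s, {in s, forall x, X x} & covers d s X].
Proof.
move=> d0 Xr.
have r0 : 0 < `|r| + 1 by rewrite ltr_wpDl.
(* Packing at scale 1, with [X] inside the ball of radius [|r| + 1] about 1. This [M] depends on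
   [d], but only its existence matters. *)
have [M _ MP] := packing_ball hG r 2 d0 r0.
have [||s us ss sX|s [us ss sX cs]] :=
    @maximal_independent_seq _ (fun x y => mdist x y < d) X M.
- by move=> x y; rewrite metric_sym.
- by move=> x _; rewrite mdistxx.
- apply: (MP 1 s 1%g); rewrite ?mulr1 ?ltr01 ?ltr1n//.
    by move=> x /sX /Xr.
  move=> x /sX /Xr; rewrite ballEmdist /cball /= => /le_lt_trans; apply.
  have := ler_norm r; lra.
exists s; split=> // x /cs [y ys yx]; exists y => //.
by rewrite ballEmdist.
Qed.

Lemma entropyE eps r X : 0 < eps -> X `<=` cball r ->
  metric_entropy eps X = (entropy eps X)%:E.
Proof.
move=> e0 Xr; have [s [_ _ cs]] := maximal_separated_cball e0 Xr.
by have [t [_ _ tE]] := covers_entropy cs; rewrite /entropy tE.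
Qed.

Lemma entropy_attained eps r X : 0 < eps -> X `<=` cball r ->
  exists2 s, covers eps s X & (size s)%:R = entropy eps X.
Proof.
move=> e0 Xr; have [s [_ _ cs]] := maximal_separated_cball e0 Xr.
by have [t [ct _ tE]] := covers_entropy cs; exists t => //; rewrite /entropy tE.
Qed.

Lemma entropy_ge0 eps r X : 0 < eps -> X `<=` cball r -> 0 <= entropy eps X.
Proof. by move=> e0 Xr; have [s _ <-] := entropy_attained e0 Xr. Qed.

Lemma entropy_ge1 eps r X : 0 < eps -> X `<=` cball r -> X !=set0 ->
  1 <= entropy eps X.
Proof.
move=> e0 Xr [x Xx]; have [[|y s] cs <-] := entropy_attained e0 Xr.
  by have [] := cs x Xx.
by rewrite ler1n.
Qed.

Lemma le_entropy eps r X Y : 0 < eps -> Y `<=` cball r -> X `<=` Y ->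
  entropy eps X <= entropy eps Y.
Proof.
move=> e0 Yr XY; have [s cs <-] := entropy_attained e0 Yr.
by apply: entropy_le_size => x /XY; exact: cs.
Qed.

Lemma entropyU eps r X Y : 0 < eps -> X `<=` cball r -> Y `<=` cball r ->
  entropy eps (X `|` Y) <= entropy eps X + entropy eps Y.
Proof.
move=> e0 Xr Yr; have [s cs <-] := entropy_attained e0 Xr.
have [t ct <-] := entropy_attained e0 Yr; rewrite -natrD -size_cat.
apply: entropy_le_size => x [/cs|/ct] [c /= cst cx]; exists c => //=;
  by rewrite mem_cat cst ?orbT.
Qed.

(** Each ball of a minimal cover holds at most [M] of the points, by [packing_ball]. The points are
    indexed by [I] because they will also be products [x * a] indexed by pairs. *)
Lemma packing_le_entropy (r rho lam nu : R) : 0 < lam -> 0 < nu ->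
  exists2 M : R, 0 < M & forall eps X (I : eqType) (p : seq I) (f : I -> G),
    0 < eps < rho -> X `<=` cball r -> uniq p -> {in p, forall i, X (f i)} ->
    {in p &, forall i j, mdist (f i) (f j) < lam * eps -> i = j} ->
    (size p)%:R <= M * entropy (nu * eps) X.
Proof.
move=> lam0 nu0; have [M M0 MP] := packing_ball hG r rho lam0 nu0.
exists M => // eps X I p f er Xr up pX psep.
have e0 : 0 < eps by case/andP: er.
have [t ct <-] := entropy_attained (mulr_gt0 nu0 e0) Xr.
apply: (@size_le_fibers _ _ (fun c i => `[< ball c (nu * eps) (f i) >])).
  by move=> i /pX /ct [c /= ct' ci]; exists c => //; apply/asboolP.
move=> c _; set q := [seq _ <- _ | _]; rewrite -(size_map f).
have qp i : i \in q -> i \in p by rewrite mem_filter => /andP[].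
apply: (MP eps _ c) => //.
- split.
    rewrite map_inj_in_uniq ?filter_uniq// => i j /qp ip /qp jp fij.
    by apply: psep => //; rewrite fij mdistxx mulr_gt0.
  move=> _ _ /mapP[i /qp ip ->] /mapP[j /qp jp ->] /psep.
  by move=> /(_ ip jp) ->.
- by move=> _ /mapP[i /qp /pX /Xr fi ->].
- by move=> _ /mapP[i + ->]; rewrite mem_filter => /andP[/asboolP].
Qed.

(** Two maximal separated sets are compared through the entropy at scale [lam * eps]: it is at most
    the size of the one separated at that scale, and bounds the size of the [eps]-separated one up
    to [M]. *)
Lemma entropy_le_packing (r rho lam : R) : 0 < lam ->
  exists2 M : R, 0 < M & forall eps X, 0 < eps < rho -> X `<=` cball r ->
    exists s, [/\ separated_seq (lam * eps) s, {in s, forall x, X x} &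
      entropy eps X <= M * (size s)%:R].
Proof.
move=> lam0; have [M M0 MP] := packing_le_entropy r rho ltr01 lam0.
exists M => // eps X er Xr; have e0 : 0 < eps by case/andP: er.
have [s [ss sX cs]] := maximal_separated_cball (mulr_gt0 lam0 e0) Xr.
exists s; split=> //.
have [t [[ut st] tX ct]] := maximal_separated_cball e0 Xr.
apply: le_trans (entropy_le_size ct) _.
apply: (@le_trans _ _ (M * entropy (lam * eps) X)).
  by apply: (MP eps X _ t id) => // x y xt yt; rewrite mul1r; exact: st.
by rewrite ler_pM2l// entropy_le_size.
Qed.

(* The additive error [eps] makes this apply to nearest-point maps from a
   neighbourhood as well as to bi-Lipschitz maps. *)
Lemma entropy_coarse_embedding (r rho L : R) : 0 < L ->
  exists2 M : R, 0 < M & forall eps X Y (f : G -> G), 0 < eps < rho ->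
    X `<=` cball r -> Y `<=` cball r -> (forall x, X x -> Y (f x)) ->
    (forall x y, X x -> X y -> mdist x y <= L * (mdist (f x) (f y) + eps)) ->
    entropy eps X <= M * entropy eps Y.
Proof.
move=> L0; have L2 : 0 < 2 * L by rewrite mulr_gt0.
have [M M0 MP] := entropy_le_packing r rho L2.
have [N N0 NP] := packing_le_entropy r rho ltr01 ltr01.
exists (M * N); first by rewrite mulr_gt0.
move=> eps X Y f er Xr Yr fXY fL.
have [s [[us ss] sX sM]] := MP eps X er Xr.
apply: le_trans sM _; rewrite -mulrA ler_pM2l//.
have := NP eps Y _ s f er Yr us; rewrite mul1r; apply.
  by move=> x /sX /fXY.
move=> x y xs ys fxy; apply: ss => //.
apply: le_lt_trans (fL x y (sX x xs) (sX y ys)) _.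
have : L * mdist (f x) (f y) < L * eps by rewrite ltr_pM2l.
rewrite mulrDr; lra.
Qed.

Lemma entropy_near (r rho b : R) : 0 < b ->
  exists2 M : R, 0 < M & forall eps X Y, 0 < eps < rho ->
    X `<=` cball r -> Y `<=` cball r ->
    (forall x, X x -> exists2 y, Y y & mdist y x <= b * eps) ->
    entropy eps X <= M * entropy eps Y.
Proof.
move=> b0; have L0 : 0 < 1 + 2 * b by rewrite addr_gt0// mulr_gt0.
have [M M0 MP] := entropy_coarse_embedding r rho L0; exists M => //.
move=> eps X Y er Xr Yr XY.
have [f fP] : {f : G -> G & forall x, X x -> Y (f x) /\ mdist (f x) x <= b * eps}.
  apply: (@choice _ _ (fun x y => X x -> Y y /\ mdist y x <= b * eps)) => x.
  by have [/XY [y Yy yx]|nX] := pselect (X x); [exists y|exists 1%g].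
apply: (MP eps X Y f) => // [x /fP[]//|x y /fP[_ hx] /fP[_ hy]].
have := metric_triangle x (f x) y; have := metric_triangle (f x) (f y) y.
have : 0 <= 2 * b * mdist (f x) (f y) by rewrite !mulr_ge0 ?mdist_ge0// ltW.
rewrite (metric_sym x (f x)) mulrDl mulrDr; case/andP: er => e0 _; lra.
Qed.

End metric_entropy_theory.

(** * Ruzsa's triangle inequality *)

Section product_estimates.
Context {R : realType} {G : metricGroupType R}.
Context {mu : {measure set (borel G) -> \bar R}}.
Hypothesis hG : locally_reasonable_metric_group mu.
Implicit Types (A P Q S X Y : set G) (eps r rho L M : R).

Lemma setmulg_cball r : exists2 r', r <= r' & forall X Y,
  X `<=` cball r -> Y `<=` cball r ->
  setmulg X Y `<=` cball r' /\ setinvg X `<=` cball r'.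
Proof.
have [r' rr' h] := cball_hull hG r; exists r' => // X Y Xr Yr; split.
  by move=> _ [x /Xr xr [y /Yr yr <-]]; have [] := h x y xr yr.
by move=> _ [x /Xr xr <-]; have [] := h x x xr xr.
Qed.

Lemma entropy_inv r rho : exists2 M, 0 < M & forall eps X Y, 0 < eps < rho ->
  X `<=` cball r -> Y `<=` cball r -> setinvg X `<=` Y ->
  entropy eps X <= M * entropy eps Y.
Proof.
have [L L1 lip] := lipschitz_cball hG r.
have [M M0 MP] := entropy_coarse_embedding hG r rho (lt_le_trans ltr01 L1).
exists M => // eps X Y er Xr Yr XY.
have fXY x : X x -> Y (x^-1)%g by move=> Xx; apply: XY; exists x.
apply: (MP eps X Y (fun x => (x^-1)%g)) => // x y Xx Xy.
have [_ _] := lip (x^-1)%g (y^-1)%g x (Yr _ (fXY x Xx)) (Yr _ (fXY y Xy)) (Xr x Xx).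
rewrite !invgK => /le_trans; apply.
by rewrite ler_pM2l ?lerDl ?(lt_le_trans ltr01 L1)// ltW//; case/andP: er.
Qed.

(** The translation by [g] and [h] is undone by multiplying with [h^-1] on the right and then [g^-1]
    on the left; each costs a factor [L], uniformly over the ball. *)
Lemma entropy_translate r rho : exists2 M, 0 < M &
  forall eps X Y (g h : G), 0 < eps < rho -> cball r g -> cball r h ->
    X `<=` cball r -> Y `<=` cball r -> (forall x, X x -> Y (g * x * h)%g) ->
    entropy eps X <= M * entropy eps Y.
Proof.
have [r1 rr1 h1] := cball_hull hG r.
have [r2 rr2 h2] := cball_hull hG r1.
have [L L1 lip] := lipschitz_cball hG r2.
have L0 : 0 < L by apply: lt_le_trans L1.
have [M M0 MP] := entropy_coarse_embedding hG r rho (mulr_gt0 L0 L0).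
exists M => // eps X Y g h er gr hr Xr Yr gXY.
apply: (MP eps X Y (fun x => (g * x * h)%g)) => // x y Xx Xy.
have [g1 g2] := h1 g g gr gr; have [_ h12] := h1 h h hr hr.
have sub1 : (cball r : set G) `<=` cball r2 by apply: le_cball; exact: le_trans rr1 rr2.
have sub2 : (cball r1 : set G) `<=` cball r2 by apply: le_cball.
have gx z : X z -> cball r2 (g * z)%g.
  by move=> Xz; apply: sub2; have [] := h1 g z gr (Xr z Xz).
have [_] := lip (g * x * h)%g (g * y * h)%g (h^-1)%g
  (sub1 _ (Yr _ (gXY x Xx))) (sub1 _ (Yr _ (gXY y Xy))) (sub2 _ h12).
rewrite !mulgK => b1 _.
have [b2 _ _] := lip (g * x)%g (g * y)%g (g^-1)%g (gx x Xx) (gx y Xy) (sub2 _ g2).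
move: b2; rewrite !mulKg => b2; apply: le_trans b2 _.
rewrite -mulrA ler_pM2l//; apply: le_trans b1 _.
by rewrite ler_pM2l// lerDl ltW//; case/andP: er.
Qed.

(** Send [i] to the centres of a ball containing [f i] and of one containing [g i]. Points sharing a
    ball of radius [eps] are less than [2 * eps] apart, so this map is injective. *)
Lemma size_le_pigeonhole (I : eqType) (p : seq I) (f g : I -> G) eps X Y s t :
  uniq p -> covers eps s X -> covers eps t Y ->
  {in p, forall i, X (f i) /\ Y (g i)} ->
  {in p &, forall i j, mdist (f i) (f j) < 2 * eps ->
    mdist (g i) (g j) < 2 * eps -> i = j} ->
  (size p <= size s * size t)%N.
Proof.
move=> up cs ct pXY inj.
have [c cP] : {c : G -> G & forall x, X x -> c x \in s /\ ball (c x) eps x}.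
  apply: (@choice _ _ (fun x y => X x -> y \in s /\ ball y eps x)) => x.
  have [/cs [y]|nX] := pselect (X x); last by exists 1%g.
  by exists y.
have [d dP] : {d : G -> G & forall x, Y x -> d x \in t /\ ball (d x) eps x}.
  apply: (@choice _ _ (fun x y => Y x -> y \in t /\ ball y eps x)) => x.
  have [/ct [y]|nX] := pselect (Y x); last by exists 1%g.
  by exists y.
have close (y x x' : G) : ball y eps x -> ball y eps x' -> mdist x x' < 2 * eps.
  rewrite !ballEmdist /= => yx yx'.
  have := metric_triangle x y x'; rewrite (metric_sym x y); lra.
rewrite -(size_allpairs pair) -(size_map (fun i => (c (f i), d (g i)))).
apply: uniq_leq_size.
  rewrite map_inj_in_uniq// => i j ip jp [ci di].
  have [Xi Yi] := pXY i ip; have [Xj Yj] := pXY j jp.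
  apply: inj => //.
    by apply: (close (c (f i))); [case: (cP _ Xi)|rewrite ci; case: (cP _ Xj)].
  by apply: (close (d (g i))); [case: (dP _ Yi)|rewrite di; case: (dP _ Yj)].
move=> _ /mapP[i /pXY [/cP [cs' _] /dP [dt _]] ->].
by apply/allpairsP; exists (c (f i), d (g i)).
Qed.

(* An element [a b] of [P S] and [q] in [Q] are
   recovered from [a q^-1] and [q b], up to errors comparable to the scale. *)
Lemma ruzsa_triangle r rho : exists2 M, 0 < M &
  forall eps P Q S, 0 < eps < rho ->
    P `<=` cball r -> Q `<=` cball r -> S `<=` cball r ->
    entropy eps (setmulg P S) * entropy eps Q <=
      M * (entropy eps (setmulg P (setinvg Q)) * entropy eps (setmulg Q S)).
Proof.
have [r1 rr1 h1] := cball_hull hG r.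
have [r2 rr2 h2] := cball_hull hG r1.
have [L L1 lip] := lipschitz_cball hG r2.
have L0 : 0 < L by apply: lt_le_trans L1.
(* Two errors below [2 * eps], each stretched by [L], give the separation [4 * L] for [P S]; one
   cancellation followed by one inversion gives [2 * (L * L)] for [Q]. *)
have [M M0 MP] := entropy_le_packing hG r2 rho (mulr_gt0 (ltr0n R 4) L0).
have [N N0 NP] := entropy_le_packing hG r2 rho (mulr_gt0 (ltr0n R 2) (mulr_gt0 L0 L0)).
exists (M * N); first exact: mulr_gt0.
move=> eps P Q S er Pr Qr Sr.
have e0 : 0 < eps by case/andP: er.
have sub1 : (cball r : set G) `<=` cball r2 by apply: le_cball; exact: le_trans rr1 rr2.
have sub2 : (cball r1 : set G) `<=` cball r2 by apply: le_cball.
have PSr : setmulg P S `<=` cball r2.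
  by move=> _ [x /Pr xr [y /Sr yr <-]]; apply: sub2; have [] := h1 x y xr yr.
have QSr : setmulg Q S `<=` cball r2.
  by move=> _ [x /Qr xr [y /Sr yr <-]]; apply: sub2; have [] := h1 x y xr yr.
have PQr : setmulg P (setinvg Q) `<=` cball r2.
  move=> _ [x /Pr xr [_ [y /Qr yr <-] <-]].
  have [] := h2 x (y^-1)%g _ _ => //; first exact: le_cball xr.
  by have [] := h1 y y yr yr.
have [s [[us ss] sPS sM]] := MP eps _ er PSr.
have [t [[ut st] tQ tN]] := NP eps Q er (fun x Qx => sub1 x (Qr x Qx)).
have [u cu <-] := entropy_attained hG e0 PQr.
have [v cv <-] := entropy_attained hG e0 QSr.
have [k kP] : {k : G -> G * G & forall z, setmulg P S z ->
    [/\ P (k z).1, S (k z).2 & ((k z).1 * (k z).2)%g = z]}.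
  apply: (@choice _ _ (fun z ab => setmulg P S z ->
    [/\ P ab.1, S ab.2 & (ab.1 * ab.2)%g = z])) => z.
  have [[a Pa [b Sb <-]]|nz] := pselect (setmulg P S z); last by exists (1%g, 1%g).
  by exists (a, b).
have key : (size [seq (z, q) | z <- s, q <- t] <= size u * size v)%N.
  apply: (@size_le_pigeonhole _ _ (fun zq => (k zq.1).1 * (zq.2)^-1)%g
    (fun zq => zq.2 * (k zq.1).2)%g eps _ _ u v _ cu cv).
  - by apply: allpairs_uniq => // -[? ?] [? ?].
  - move=> _ /allpairsP[[z q] /= [/sPS /kP [Pz Sz _] /tQ Qq ->]] /=; split.
      by exists (k z).1 => //; exists (q^-1)%g => //; exists q.
    by exists q => //; exists (k z).2.
  move=> _ _ /allpairsP[[z q] /= [zs qt ->]] /allpairsP[[w p] /= [ws pt ->]] /=.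
  have [Pz Sz kz] := kP z (sPS z zs); have [Pw Sw kw] := kP w (sPS w ws).
  have [Qq Qp] := (tQ q qt, tQ p pt).
  have mPQ a b : P a -> Q b -> cball r2 (a * b^-1)%g.
    by move=> Pa Qb; apply: PQr; exists a => //; exists (b^-1)%g => //; exists b.
  have mQS a b : Q a -> S b -> cball r2 (a * b)%g.
    by move=> Qa Sb; apply: QSr; exists a => //; exists b.
  move=> d1 d2.
  (* The path from [z] to [w] goes through the first factor of [w] times [p^-1 q] times the second
     factor of [z], so that each half changes only one of the two recorded products. *)
  have zw : z = w.
    apply: ss => //.
    have [_ b1 _] := lip _ _ _ (mPQ _ _ Pz Qq) (mPQ _ _ Pw Qp) (mQS _ _ Qq Sz).
    have [b2 _ _] := lip _ _ _ (mQS _ _ Qq Sz) (mQS _ _ Qp Sw) (mPQ _ _ Pw Qp).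
    move: b1 b2; rewrite !mulgA !mulgVK kz kw => b1 b2.
    have := metric_triangle z ((k w).1 * p^-1 * q * (k z).2)%g w.
    move: d1 d2; rewrite -(ltr_pM2l L0) => d1; rewrite -(ltr_pM2l L0); lra.
  (* Both pairs now use the same chosen factor in [P]; cancelling it and inverting brings [q] close
     to [p]. *)
  move: d1; rewrite -zw => d1.
  have inv x : Q x -> cball r2 (x^-1)%g.
    by move=> /Qr xr; apply: sub2; have [] := h1 x x xr xr.
  have invP x : P x -> cball r2 (x^-1)%g.
    by move=> /Pr xr; apply: sub2; have [] := h1 x x xr xr.
  congr (_, _); apply: st => //.
  have [b1 _ _] := lip _ _ _ (mPQ _ _ Pz Qq) (mPQ _ _ Pz Qp) (invP _ Pz).
  move: b1; rewrite !mulKg => b1.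
  have [_ _ b2] := lip _ _ (q^-1)%g (inv _ Qq) (inv _ Qp) (inv _ Qq).
  move: b2; rewrite !invgK => b2; apply: le_lt_trans b2 _.
  rewrite -!mulrA [2 * _]mulrCA ltr_pM2l// [2 * _]mulrCA; apply: le_lt_trans b1 _.
  by rewrite ltr_pM2l.
rewrite size_allpairs -(ler_nat R) !natrM in key.
apply: le_trans (ler_pM _ _ sM tN) _.
- exact: (entropy_ge0 hG e0 PSr).
- exact: (entropy_ge0 hG e0 Qr).
by rewrite mulrACA ler_pM2l// mulr_gt0.
Qed.

End product_estimates.

(** * Algebra of product sets *)

Section product_set_algebra.
Context {R : realType} {G : metricGroupType R}.
Implicit Types A B X Y Z : set G.

Lemma setmulgA : associative (@setmulg R G).
Proof.
move=> X Y Z; apply/seteqP; split.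
  move=> _ [x Xx [_ [y Yy [z Zz <-]] <-]].
  by exists (x * y)%g; [exists x => //; exists y|exists z; rewrite ?mulgA].
move=> _ [_ [x Xx [y Yy <-]] [z Zz <-]].
by exists x => //; exists (y * z)%g; [exists y => //; exists z|rewrite mulgA].
Qed.

Lemma setmul1g X : setmulg [set 1%g] X = X.
Proof.
apply/seteqP; split=> [_ [_ -> [x Xx <-]]|x Xx]; first by rewrite mul1g.
by exists 1%g => //; exists x; rewrite ?mul1g.
Qed.

Lemma setmulg1 X : setmulg X [set 1%g] = X.
Proof.
apply/seteqP; split=> [_ [x Xx [_ -> <-]]|x Xx]; first by rewrite mulg1.
by exists x => //; exists 1%g; rewrite ?mulg1.
Qed.

Lemma setmulgS X X' Y Y' : X `<=` X' -> Y `<=` Y' ->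
  setmulg X Y `<=` setmulg X' Y'.
Proof. by move=> XX YY _ [x /XX Xx [y /YY Yy <-]]; exists x => //; exists y. Qed.

Lemma setmulgUl X Y Z : setmulg (X `|` Y) Z = setmulg X Z `|` setmulg Y Z.
Proof.
apply/seteqP; split.
  by move=> _ [x [Xx|Yx] [z Zz <-]]; [left|right]; exists x => //; exists z.
by move=> _ [] [x Xx [z Zz <-]]; exists x; [left| |right|] => //; exists z.
Qed.

Lemma setmulgUr X Y Z : setmulg X (Y `|` Z) = setmulg X Y `|` setmulg X Z.
Proof.
apply/seteqP; split.
  by move=> _ [x Xx [y [Yy|Zy] <-]]; [left|right]; exists x => //; exists y.
by move=> _ [] [x Xx [z Zz <-]]; exists x => //; exists z => //; [left|right].
Qed.

Lemma setinvgK : involutive (@setinvg R G).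
Proof.
move=> X; apply/seteqP; split=> [_ [_ [x Xx <-] <-]|x Xx]; first by rewrite invgK.
by exists (x^-1)%g; rewrite ?invgK//; exists x.
Qed.

Lemma setinvgS X Y : X `<=` Y -> setinvg X `<=` setinvg Y.
Proof. by move=> XY _ [x /XY Yx <-]; exists x. Qed.

Lemma setinvgM X Y : setinvg (setmulg X Y) = setmulg (setinvg Y) (setinvg X).
Proof.
apply/seteqP; split.
  move=> _ [_ [x Xx [y Yy <-]] <-]; rewrite invgM.
  by exists (y^-1)%g; [exists y|exists (x^-1)%g => //; exists x].
move=> _ [_ [y Yy <-] [_ [x Xx <-] <-]].
by exists (x * y)%g; [exists x => //; exists y|rewrite invgM].
Qed.

Lemma setinvgU X Y : setinvg (X `|` Y) = setinvg X `|` setinvg Y.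
Proof. by rewrite /setinvg image_setU. Qed.

Lemma setinvg1 : setinvg [set 1%g : G] = [set 1%g].
Proof. by rewrite /setinvg image_set1 invg1. Qed.

Definition setexpg X n : set G := iter n (setmulg X) [set 1%g].

Lemma setexpgD X m n : setexpg X (m + n) = setmulg (setexpg X m) (setexpg X n).
Proof.
by elim: m => [|m IH]; rewrite /= ?setmul1g// -setmulgA -IH.
Qed.

Lemma setexpg1 X : setexpg X 1 = X.
Proof. exact: setmulg1. Qed.

Lemma setexpgS X n : setexpg X n.+1 = setmulg X (setexpg X n).
Proof. by []. Qed.

Lemma le_setexpg X m n : X 1%g -> (m <= n)%N -> setexpg X m `<=` setexpg X n.
Proof.
move=> X1 /subnK <-; elim: (n - m)%N => // k; rewrite addSn => /subset_trans.
by apply=> x Xx; exists 1%g => //; exists x; rewrite ?mul1g.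
Qed.

Lemma setinvg_setexpg X n : setinvg X = X -> setinvg (setexpg X n) = setexpg X n.
Proof.
move=> Xsym; elim: n => [|n IH]; first exact: setinvg1.
by rewrite setexpgS setinvgM IH Xsym -{2}(setexpg1 X) -setexpgD addnC.
Qed.

(** The point 1 is included so that the powers increase with the exponent. *)
Definition symmetrize A : set G := A `|` setinvg A `|` [set 1%g].

Lemma sub_symmetrize A : A `<=` symmetrize A.
Proof. by move=> x; left; left. Qed.

Lemma sub_symmetrizeV A : setinvg A `<=` symmetrize A.
Proof. by move=> x; left; right. Qed.

Lemma symmetrize1 A : symmetrize A 1%g.
Proof. by right. Qed.

Lemma setinvg_symmetrize A : setinvg (symmetrize A) = symmetrize A.
Proof.
rewrite /symmetrize !setinvgU setinvgK setinvg1.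
by rewrite [in LHS](setUC (setinvg A)).
Qed.

Lemma signed_product_cube A :
  signed_product (fun _ : 'I_3 => false) A = setmulg (setmulg A A) A.
Proof.
by rewrite /signed_product !big_ord_recl big_ord0 /= setmulg1 setmulgA.
Qed.

End product_set_algebra.
Arguments setexpg : simpl never.

(** * Consequences of small tripling *)

Section small_tripling_consequences.
Context {R : realType} {G : metricGroupType R}.
Context {mu : {measure set (borel G) -> \bar R}}.
Hypothesis hG : locally_reasonable_metric_group mu.
Context {r rho : R}.
Implicit Types (A : set G) (F P Q S : set G -> set G) (eps D M : R).

(** [D] stands for the whole loss, implied constant and power of [K] together, so that later bounds
    are just [M * D ^+ j]; [K] returns only at the end. *)
Definition tripling eps A D : Prop :=
  [/\ 0 < eps < rho, A `<=` cball r, A !=set0, 1 <= D &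
    entropy eps (setmulg (setmulg A A) A) <= D * entropy eps A].

(** Words in [A] are handled as maps on sets, so that the radius here, and [M] and [j] in
    [controlled], are fixed before [A], the scale and [D]. *)
Definition bounded_family F : Prop :=
  exists r', forall A, A `<=` cball r -> F A `<=` cball r'.

Definition controlled F : Prop :=
  exists M j, 0 < M /\ forall eps A D, tripling eps A D ->
    entropy eps (F A) <= M * D ^+ j * entropy eps A.

Lemma bounded_family2 F P : bounded_family F -> bounded_family P ->
  exists2 r', r <= r' & forall A, A `<=` cball r ->
    F A `<=` cball r' /\ P A `<=` cball r'.
Proof.
move=> [a ha] [b hb]; exists (Num.max r (Num.max a b)); first by rewrite le_max lexx.
move=> A Ar; split=> x.
  by move/(ha A Ar); apply: le_cball; rewrite !le_max lexx orbT.
by move/(hb A Ar); apply: le_cball; rewrite !le_max lexx !orbT.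
Qed.

Lemma bounded_id : bounded_family id.
Proof. by exists r. Qed.

Lemma bounded_setmulg F P : bounded_family F -> bounded_family P ->
  bounded_family (fun A => setmulg (F A) (P A)).
Proof.
move=> /bounded_family2 /[apply] -[a _ ha].
have [b _ hb] := setmulg_cball hG a; exists b => A Ar.
by have [Fa Pa] := ha A Ar; have [] := hb _ _ Fa Pa.
Qed.

Lemma bounded_setinvg F : bounded_family F -> bounded_family (setinvg \o F).
Proof.
move=> [a ha]; have [b _ hb] := setmulg_cball hG a; exists b => A Ar.
by have [] := hb _ _ (ha A Ar) (ha A Ar).
Qed.

Lemma bounded_symmetrize : bounded_family symmetrize.
Proof.
have [b _ hb] := bounded_family2 bounded_id (bounded_setinvg bounded_id).
exists (`|b|) => A Ar x; have [h1 h2] := hb A Ar.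
move=> [[/h1|/h2]|->]; try exact/le_cball/ler_norm.
exact/cball1/normr_ge0.
Qed.

Lemma bounded_setU F P : bounded_family F -> bounded_family P ->
  bounded_family (fun A => F A `|` P A).
Proof.
move=> /bounded_family2 /[apply] -[a _ ha]; exists a => A Ar.
by have [Fa Pa] := ha A Ar; rewrite subUset.
Qed.

Lemma bounded_setexpg F n : bounded_family F ->
  bounded_family (fun A => setexpg (F A) n).
Proof.
move=> bF; elim: n => [|n IH]; last exact: bounded_setmulg.
by exists 0 => A _ x ->; exact: cball1.
Qed.

Lemma expr_bound (M D x : R) i j : 0 <= M -> 1 <= D -> 0 <= x -> (i <= j)%N ->
  M * D ^+ i * x <= M * D ^+ j * x.
Proof.
by move=> M0 D1 x0 ij; rewrite ler_wpM2r// ler_wpM2l// ler_weXn2l.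
Qed.

Lemma entropy_tripling_ge1 eps A D : tripling eps A D -> 1 <= entropy eps A.
Proof. by move=> [/andP[e0 _] Ar A0 _ _]; exact: (entropy_ge1 hG e0 Ar). Qed.

Lemma controlled_sub F P : bounded_family P -> (forall A, F A `<=` P A) ->
  controlled P -> controlled F.
Proof.
move=> [r' Pr] FP [M [j [M0 MP]]]; exists M, j; split=> // eps A D h.
have [/andP[e0 _] Ar _ _ _] := h.
exact: le_trans (le_entropy hG e0 (Pr A Ar) (FP A)) (MP eps A D h).
Qed.

Lemma controlled_id : controlled id.
Proof. by exists 1, 0%N; split=> // eps A D _; rewrite expr0 !mul1r. Qed.

Lemma controlledU F P : bounded_family F -> bounded_family P ->
  controlled F -> controlled P -> controlled (fun A => F A `|` P A).
Proof.
move=> /bounded_family2 /[apply] -[r' _ hr] [M [j [M0 MP]]] [N [k [N0 NP]]].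
exists (M + N), (maxn j k); split; first by rewrite addr_gt0.
move=> eps A D h; have [/andP[e0 _] Ar _ D1 _] := h.
have x0 := le_trans ler01 (entropy_tripling_ge1 h).
have [Fr Pr] := hr A Ar; apply: le_trans (entropyU hG e0 Fr Pr) _.
rewrite !mulrDl lerD//.
  by apply: le_trans (MP eps A D h) _; apply: expr_bound; rewrite ?(ltW M0) ?leq_maxl.
by apply: le_trans (NP eps A D h) _; apply: expr_bound; rewrite ?(ltW N0) ?leq_maxr.
Qed.

(** For any [x] in [A], the translate [F A x] lies in [F A A]. *)
Lemma controlled_of_setmulg F : bounded_family F ->
  controlled (fun A => setmulg (F A) A) -> controlled F.
Proof.
move=> bF [M [j [M0 MP]]].
have [a ra ha] := bounded_family2 bF (bounded_setmulg bF bounded_id).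
have sub : (cball a : set G) `<=` cball `|a| by apply: le_cball; exact: ler_norm.
have [N N0 NP] := entropy_translate hG `|a| rho.
exists (N * M), j; split; first by rewrite mulr_gt0.
move=> eps A D H; have [er Ar [x Ax] D1 _] := H; have [Fa FAa] := ha A Ar.
apply: (@le_trans _ _ (N * entropy eps (setmulg (F A) A))).
  apply: (NP eps _ _ 1%g x) => //.
  - exact/cball1/normr_ge0.
  - by apply: sub; apply: le_cball ra _ _; exact: Ar.
  - exact: subset_trans sub.
  - exact: subset_trans sub.
  - by move=> y Fy; rewrite mul1g; exists y => //; exists x.
by rewrite -!mulrA ler_pM2l// mulrA; exact: MP.
Qed.

Lemma controlled_setinvg F : bounded_family F -> controlled F ->
  controlled (fun A => setinvg (F A)).
Proof.
move=> bF; have [a _ ha] := bounded_family2 bF (bounded_setinvg bF).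
have [N N0 NP] := entropy_inv hG a rho => -[M [j [M0 MP]]].
exists (N * M), j; split; first by rewrite mulr_gt0.
move=> eps A D H; have [er Ar A0 D1 _] := H; have [Fa Fa'] := ha A Ar.
apply: (@le_trans _ _ (N * entropy eps (F A))).
  by apply: NP => //; rewrite setinvgK.
by rewrite -!mulrA ler_pM2l// mulrA; exact: MP.
Qed.

(** The two controlled factors produce the square of the entropy of [A]; the lower bound on the
    entropy of [Q A] allows one of them to be divided out. *)
Lemma controlled_ruzsa P Q S :
  bounded_family P -> bounded_family Q -> bounded_family S ->
  (exists2 c : R, 0 < c & forall eps A D, tripling eps A D ->
    entropy eps A <= c * entropy eps (Q A)) ->
  controlled (fun A => setmulg (P A) (setinvg (Q A))) ->
  controlled (fun A => setmulg (Q A) (S A)) ->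
  controlled (fun A => setmulg (P A) (S A)).
Proof.
move=> bP bQ bS [c c0 cQ] [M [j [M0 MP]]] [N [k [N0 NP]]].
have [a _ ha] := bounded_family2 bP bQ; have [b _ hb] := bounded_family2 bP bS.
have [L L0 LP] := ruzsa_triangle hG (Num.max a b) rho.
exists (c * L * M * N), (j + k)%N; split; first by rewrite !mulr_gt0.
move=> eps A D H; have [er Ar A0 D1 _] := H; have [e0 _] := andP er.
have [Pa Qa] := ha A Ar; have [Pb Sb] := hb A Ar.
have ma : (cball a : set G) `<=` cball (Num.max a b).
  by apply: le_cball; rewrite le_max lexx.
have mb : (cball b : set G) `<=` cball (Num.max a b).
  by apply: le_cball; rewrite le_max lexx orbT.
have := LP eps (P A) (Q A) (S A) er (subset_trans Pa ma) (subset_trans Qa ma)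
  (subset_trans Sb mb).
have hM := MP eps A D H; have hN := NP eps A D H.
have hQ := cQ eps A D H; have hA := entropy_tripling_ge1 H.
have [p hp] := bounded_setmulg bP bS.
have PS0 : 0 <= entropy eps (setmulg (P A) (S A)) by apply: (entropy_ge0 hG e0 (hp A Ar)).
have [q hq] := bounded_setmulg bP (bounded_setinvg bQ).
have PQ0 : 0 <= entropy eps (setmulg (P A) (setinvg (Q A))).
  by apply: (entropy_ge0 hG e0 (hq A Ar)).
have [s hs] := bounded_setmulg bQ bS.
have QS0 : 0 <= entropy eps (setmulg (Q A) (S A)) by apply: (entropy_ge0 hG e0 (hs A Ar)).
move=> hL; have A1 : 0 < entropy eps A by apply: lt_le_trans hA.
rewrite -(ler_pM2r A1).
apply: (@le_trans _ _ (entropy eps (setmulg (P A) (S A)) * (c * entropy eps (Q A)))).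
  exact: ler_wpM2l.
rewrite mulrCA.
apply: (@le_trans _ _ (c * (L * ((M * D ^+ j * entropy eps A) *
    (N * D ^+ k * entropy eps A))))).
  rewrite ler_pM2l//; apply: le_trans hL _; rewrite ler_pM2l//.
  exact: ler_pM.
by rewrite exprD le_eqVlt; apply/orP; left; apply/eqP; ring.
Qed.

Let bV : bounded_family setinvg := bounded_setinvg bounded_id.

Lemma controlled_ruzsaV P S : bounded_family P -> bounded_family S ->
  controlled (fun A => setmulg (P A) A) ->
  controlled (fun A => setmulg (setinvg A) (S A)) ->
  controlled (fun A => setmulg (P A) (S A)).
Proof.
move=> bP bS cP; apply: controlled_ruzsa => //.
  have [a _ ha] := bounded_family2 bounded_id bV.
  have [N N0 NP] := entropy_inv hG a rho; exists N => // eps A D [er Ar _ _ _].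
  by have [Aa Va] := ha A Ar; exact: NP.
by under eq_fun do rewrite setinvgK.
Qed.

Lemma controlled_ruzsa_id P S : bounded_family P -> bounded_family S ->
  controlled (fun A => setmulg (P A) (setinvg A)) ->
  controlled (fun A => setmulg A (S A)) ->
  controlled (fun A => setmulg (P A) (S A)).
Proof.
move=> bP bS; apply: (@controlled_ruzsa P id S) => //; first exact: bounded_id.
by exists 1 => // eps A D _; rewrite mul1r.
Qed.

Let T : set G -> set G := symmetrize.

(** The word [A A^-1 A] is never estimated by itself: [A T A^-1] expands only into [A A A^-1],
    [A A^-1 A^-1] and [A A^-1], all accessible from [A A A], and the remaining words are absorbed by
    Ruzsa's inequality with [T] left unexpanded. *)
Lemma controlled_symmetrize3 : controlled (fun A => setexpg (symmetrize A) 3).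
Proof.
have bA := bounded_id; have bT : bounded_family T := bounded_symmetrize.
have bAA := bounded_setmulg bA bA; have bVV := bounded_setmulg bV bV.
have bAV := bounded_setmulg bA bV; have bAT := bounded_setmulg bA bT.
have cAAA : controlled (fun A => setmulg (setmulg A A) A).
  by exists 1, 1%N; split=> // eps A D [_ _ _ _]; rewrite mul1r expr1.
have cAA : controlled (fun A => setmulg A A) by apply: controlled_of_setmulg.
have cV : controlled setinvg by apply: (controlled_setinvg bA); exact: controlled_id.
have cVV : controlled (fun A => setmulg (setinvg A) (setinvg A)).
  by under eq_fun do rewrite -setinvgM; exact: (controlled_setinvg bAA).
have cAV : controlled (fun A => setmulg A (setinvg A)) by exact: controlled_ruzsaV.
have cAAV : controlled (fun A => setmulg (setmulg A A) (setinvg A)).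
  exact: controlled_ruzsaV.
have cAVV : controlled (fun A => setmulg (setmulg A (setinvg A)) (setinvg A)).
  have := controlled_setinvg (bounded_setmulg bAA bV) cAAV.
  by under eq_fun do rewrite !setinvgM setinvgK setmulgA.
have cTV : controlled (fun A => setmulg (T A) (setinvg A)).
  under eq_fun do rewrite !setmulgUl setmul1g.
  apply: controlledU => //; last exact: controlledU.
  by apply: bounded_setU.
have cAT : controlled (fun A => setmulg A (T A)).
  have := controlled_setinvg (bounded_setmulg bT bV) cTV.
  by under eq_fun do rewrite setinvgM setinvgK setinvg_symmetrize.
have cATV : controlled (fun A => setmulg (setmulg A (T A)) (setinvg A)).
  under eq_fun do rewrite !setmulgUr setmulg1 !setmulgUl.
  apply: controlledU => //; last by apply: controlledU => //; exact: bounded_setmulg.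
  by apply: bounded_setU; exact: bounded_setmulg.
(* Here [P = A T], [Q = A] and [S = T]; words such as [A A^-1 A] enter at this point. *)
have cATT : controlled (fun A => setmulg (setmulg A (T A)) (T A)).
  exact: controlled_ruzsa_id.
have cTTT : controlled (fun A => setmulg (T A) (setmulg (T A) (T A))).
  apply: controlled_ruzsa_id => //; first exact: bounded_setmulg.
  by under eq_fun do rewrite setmulgA.
by under eq_fun do rewrite 2!setexpgS setexpg1.
Qed.

Lemma controlled_symmetrize n : controlled (fun A => setexpg (symmetrize A) n).
Proof.
have bTn k : bounded_family (fun A => setexpg (T A) k).
  by apply: bounded_setexpg; exact: bounded_symmetrize.
(* The induction starts at exponent 3; smaller powers are contained in larger ones. *)
suff cT : controlled (fun A => setexpg (T A) (n + 3)).
  apply: controlled_sub (bTn (n + 3)%N) _ cT => A.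
  by apply: le_setexpg; [exact: symmetrize1|exact: leq_addr].
elim: n => [|n IH]; first exact: controlled_symmetrize3.
(* The exponent [n + 4] is split as [2 + (n + 2)]. With [Q = A], the two sets to control are
   [T^2 A^-1], inside [T^3], and [A T^(n+2)], inside [T^(n+3)]. *)
under eq_fun do rewrite addSnnS addnC (setexpgD _ 2 n.+2).
apply: controlled_ruzsa_id => //.
  apply: controlled_sub (bTn 3) _ controlled_symmetrize3 => A.
  rewrite (setexpgD _ 2 1) setexpg1; apply: setmulgS => //.
  exact: sub_symmetrizeV.
apply: controlled_sub (bTn (n + 3)%N) _ IH => A.
rewrite addn3 setexpgS; apply: setmulgS => //; exact: sub_symmetrize.
Qed.

End small_tripling_consequences.

(** * Approximate groups from small tripling *)

Section approximate_group_construction.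
Context {R : realType} {G : metricGroupType R}.
Context {mu : {measure set (borel G) -> \bar R}}.
Hypothesis hG : locally_reasonable_metric_group mu.
Implicit Types (A X Y V : set G) (r rho eps b D : R).

Lemma setexpg_cball r n : exists r', forall X, X `<=` cball r ->
  setexpg X n `<=` cball r'.
Proof. by have [r' h] := bounded_setexpg hG n (@bounded_id _ G r); exists r'. Qed.

(** One factor is replaced at a time, passing from [t u] to [v y] through [t y]; whence the constant
    [L * c + L * b]. *)
Lemma setexpg_near r b n : 0 < b -> exists2 c, 0 < c & forall eps X Y,
  0 < eps -> X `<=` cball r -> Y `<=` cball r ->
  (forall x, X x -> exists2 y, Y y & mdist y x <= b * eps) ->
  forall x, setexpg X n x -> exists2 y, setexpg Y n y & mdist y x <= c * eps.
Proof.
move=> b0; elim: n => [|n [c c0 IH]].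
  exists 1 => // eps X Y e0 _ _ _ _ ->; exists 1%g => //.
  by rewrite mdistxx mul1r ltW.
have [a ha] := setexpg_cball r n.
have [L L1 lip] := lipschitz_cball hG (Num.max r a).
have L0 : 0 < L by apply: lt_le_trans L1.
have mr : (cball r : set G) `<=` cball (Num.max r a).
  by apply: le_cball; rewrite le_max lexx.
have ma : (cball a : set G) `<=` cball (Num.max r a).
  by apply: le_cball; rewrite le_max lexx orbT.
exists (L * c + L * b); first by rewrite addr_gt0 ?mulr_gt0.
move=> eps X Y e0 Xr Yr XY _ [v Xv [y Xy <-]].
have [t Yt tv] := XY v Xv; have [u Yu uy] := IH eps X Y e0 Xr Yr XY y Xy.
exists (t * u)%g; first by exists t => //; exists u.
have tr := mr _ (Yr _ Yt); have vr := mr _ (Xr _ Xv).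
have ur := ma _ (ha _ Yr _ Yu); have yr := ma _ (ha _ Xr _ Xy).
have [h1 _ _] := lip u y t ur yr tr; have [_ h2 _] := lip t v y tr vr yr.
apply: le_trans (metric_triangle _ (t * y)%g _) _.
rewrite mulrDl lerD//.
  by apply: le_trans h1 _; rewrite -mulrA ler_pM2l.
by apply: le_trans h2 _; rewrite -mulrA ler_pM2l.
Qed.

Lemma open_setmulg X Y : open Y -> open (setmulg X Y).
Proof.
move=> oY; have -> : setmulg X Y = \bigcup_(x in X) setmulg [set x] Y.
  apply/seteqP; split=> [_ [x Xx [y Yy <-]]|_ [x Xx [_ -> [y Yy <-]]]].
    by exists x => //; exists x => //; exists y.
  by exists x => //; exists y.
by apply: bigcup_open => x _; exact: open_translate.
Qed.

Lemma open_setinvg X : open X -> open (setinvg X).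
Proof.
move=> oX; have -> : setinvg X = (fun x : G => (x^-1)%g) @^-1` X.
  apply/seteqP; split=> [_ [x Xx <-]|x Xx]; first by rewrite /= invgK.
  by exists (x^-1)%g; rewrite ?invgK.
by apply: open_comp => // x _; exact: invg_continuous.
Qed.

(** The inverse of a metric ball need not be a ball, so [W] may fail to be symmetric even when [X]
    is; its inverse is added by hand. *)
Definition symmetric_nbhd eps X : set G :=
  let W := \bigcup_(x in X) ball x eps in W `|` setinvg W.

Lemma sub_symmetric_nbhd eps X : 0 < eps -> X `<=` symmetric_nbhd eps X.
Proof. by move=> e0 x Xx; left; exists x => //; exact: ballxx. Qed.

Lemma ball_symmetric_nbhd eps X x : X x -> ball x eps `<=` symmetric_nbhd eps X.
Proof. by move=> Xx y xy; left; exists x. Qed.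

Lemma setinvg_symmetric_nbhd eps X :
  setinvg (symmetric_nbhd eps X) = symmetric_nbhd eps X.
Proof. by rewrite /symmetric_nbhd setinvgU setinvgK setUC. Qed.

Lemma open_symmetric_nbhd eps X : open (symmetric_nbhd eps X).
Proof.
have oW : open (\bigcup_(x in X) ball x eps).
  by apply: bigcup_open => x _; exact: open_ball_metric.
by apply: openU => //; exact: open_setinvg.
Qed.

Lemma symmetric_nbhd_cball r rho : exists r', exists2 b, 0 < b &
  forall eps X, 0 < eps < rho -> X `<=` cball r -> setinvg X = X ->
    symmetric_nbhd eps X `<=` cball r' /\
    forall x, symmetric_nbhd eps X x -> exists2 y, X y & mdist y x <= b * eps.
Proof.
have [a ra ha] := cball_hull hG (r + `|rho|).
have [L L1 lip] := lipschitz_cball hG (r + `|rho|).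
have L0 : 0 < L by apply: lt_le_trans L1.
exists a, L => // eps X /andP[e0 er] Xr Xsym.
have near y x : X y -> ball y eps x -> cball (r + `|rho|) x.
  move=> /Xr; rewrite ballEmdist /cball /= => yr yx.
  have := metric_triangle 1%g y x; have := ler_norm rho; lra.
have sub : (cball r : set G) `<=` cball (r + `|rho|).
  by apply: le_cball; rewrite lerDl.
split=> x [[y Xy yx]|[z [y Xy yz] <-]].
- by apply: le_cball ra _ _; exact: (near y).
- by have zr := near _ _ Xy yz; have [] := ha z z zr zr.
- exists y => //; move: yx; rewrite ballEmdist /= => /ltW /le_trans; apply.
  by rewrite ler_peMl// ltW.
(* For the inverse part, [z^-1] is within [L * eps] of [y^-1], which lies in [X] by symmetry; hence
   [b = L]. *)
exists (y^-1)%g; first by rewrite -Xsym; exists y.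
have zr := near _ _ Xy yz; have yr := sub _ (Xr _ Xy).
have [_ _] := lip y z y yr zr yr; move=> /le_trans; apply.
by rewrite ler_pM2l// ltW//; move: yz; rewrite ballEmdist.
Qed.

(** Ruzsa's covering argument: if [x V] meets [y V], then [x] lies in [y V V^-1 = y V V]. This is
    why the approximate group is [V V] and not [V], and why the centres range over
    [V^4 = (V V)(V V)]. *)
Lemma approximate_group_covering V (B : R) :
  open V -> V 1%g -> setinvg V = V -> precompact (setmulg V V) ->
  (forall s : seq G, uniq s -> {in s, forall x, setexpg V 4 x} ->
    {in s &, forall x y,
      setmulg [set x] V `&` setmulg [set y] V !=set0 -> x = y} ->
    (size s)%:R <= B) ->
  approximate_group (2 * B) (setmulg V V).
Proof.
move=> oV V1 Vsym pV sB.
have VVV : setmulg (setmulg V V) (setmulg V V) = setexpg V 4.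
  by rewrite (setexpgD _ 2 2) !setexpgS setmulg1.
have V4sym := setinvg_setexpg 4 Vsym.
have [||s us ss sV|s [us ss sV cs]] := @maximal_independent_seq _ _
  (fun x y => setmulg [set x] V `&` setmulg [set y] V !=set0) (setexpg V 4) B.
- by move=> x y [z [xz yz]]; exists z.
- by move=> x _; exists (x * 1)%g; split; exists x => //; exists 1%g.
- exact: sB.
split.
- split; [|exact: open_setmulg|exact: pV].
  by exists (1 * 1)%g; exists 1%g => //; exists 1%g.
- by rewrite setinvgM Vsym.
(* The covering set must be symmetric; adjoining the inverses stays in [V^4] and accounts for the
   factor 2. *)
pose S := s ++ [seq (x^-1)%g | x <- s].
have SV x : x \in S -> (x^-1)%g \in S.
  rewrite !mem_cat => /orP[xs|/mapP[y ys ->]].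
    by apply/orP; right; exact: map_f.
  by rewrite invgK ys.
have [X XE Xsz] : exists2 X : {fset G}, X =i S & (#|` X| <= size S)%N.
  exists (seq_fset tt S); first exact: seq_fsetE.
  by rewrite size_seq_fset size_undup.
exists X; split.
- apply/seteqP; split=> [_ [x + <-]|x]; rewrite /= !XE; first exact: SV.
  by move=> /SV xS; exists (x^-1)%g; rewrite ?invgK//= XE.
- rewrite VVV => x /=; rewrite XE mem_cat.
  move=> /orP[|/mapP[y ys ->]]; first exact: sV.
  by rewrite -V4sym; exists y => //; exact: sV.
- apply: (@le_trans _ _ (2 * (size s)%:R)); last by rewrite ler_pM2l// sB.
  rewrite -natrM ler_nat; apply: leq_trans Xsz _.
  by rewrite size_cat size_map mul2n addnn.
- rewrite VVV => x /cs [y ys [z [[_ -> [v Vv yv]] [_ -> [w Vw xw]]]]].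
  exists y; first by rewrite /= XE mem_cat ys.
  exists (v * w^-1)%g.
    by exists v => //; exists (w^-1)%g => //; rewrite -Vsym; exists w.
  by rewrite mulgA yv -xw mulgK.
Qed.

Lemma approximate_group_of_tripling r rho : exists r' M j, 0 < M /\ forall eps A D,
  @tripling _ _ r rho eps A D -> exists H : set G,
    [/\ approximate_group (M * D ^+ j) H,
      entropy eps H <= M * D ^+ j * entropy eps A, A `<=` H & H `<=` cball r'].
Proof.
have [r1 bT] := @bounded_symmetrize _ _ _ hG r.
have [r2 [b b0 hV]] := symmetric_nbhd_cball r1 rho.
pose r3 := Num.max r1 r2.
have [r4 bV] := setexpg_cball r3 5.
have [c c0 near] := setexpg_near r3 5 b0.
have [L L1 lip] := lipschitz_cball hG r4.
have L0 : 0 < L by apply: lt_le_trans L1.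
have [M1 M10 hM1] := entropy_near hG r4 rho c0.
(* The exponent is 5 because centres in [V^4] will be multiplied by points of [A], a subset of
   [V]. *)
have [M2 [j [M20 hM2]]] := controlled_symmetrize hG (r := r) (rho := rho) 5.
have Li : 0 < L^-1 by rewrite invr_gt0.
have [M3 M30 hM3] := packing_le_entropy hG r4 rho Li ltr01.
have [M4 M40 hM4] := entropy_le_packing hG r rho ltr01.
(* The first summand bounds the entropy of [V V], the second the number of translates after
   symmetrisation. *)
pose B := M1 * M2 + 2 * (M3 * M1 * M2 * M4).
have B0 : 0 < B by rewrite addr_gt0 ?mulr_gt0.
exists r4, B, j; split=> // eps A D h; have [er Ar A0 D1 _] := h.
have [e0 _] := andP er.
have Tr := bT A Ar; set T := symmetrize A in Tr.
have [V2 Vnear] := hV eps T er Tr (setinvg_symmetrize A).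
set V := symmetric_nbhd eps T in V2 Vnear.
have V3 : V `<=` cball r3.
  by apply: subset_trans V2 _; apply: le_cball; rewrite le_max lexx orbT.
have T3 : T `<=` cball r3.
  by apply: subset_trans Tr _; apply: le_cball; rewrite le_max lexx.
have TV : T `<=` V := sub_symmetric_nbhd e0.
have V1 : V 1%g by apply: TV; exact: symmetrize1.
have V5 := bV _ V3; have T5 := bV _ T3.
have VV : setmulg V V = setexpg V 2 by rewrite !setexpgS setmulg1.
have sub k : (k <= 5)%N -> setexpg V k `<=` setexpg V 5 by exact: le_setexpg.
have VVsub : setmulg V V `<=` setexpg V 5 by rewrite VV; exact: sub.
have D0 : 0 < D ^+ j by rewrite exprn_gt0// (lt_le_trans ltr01).
have entV : entropy eps (setexpg V 5) <= M1 * M2 * D ^+ j * entropy eps A.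
  apply: le_trans (hM1 eps _ _ er V5 T5 (near eps V T e0 V3 T3 Vnear)) _.
  by rewrite -!mulrA ler_pM2l// mulrA; exact: hM2.
have A1 := entropy_tripling_ge1 hG h; have eA0 : 0 < entropy eps A by lra.
exists (setmulg V V); split; last 3 first.
- apply: le_trans (le_entropy hG e0 V5 VVsub) _; apply: le_trans entV _.
  by rewrite ler_pM2r// ler_pM2r// lerDl ltW// !mulr_gt0.
- move=> x Ax; exists x; last by exists 1%g; rewrite ?mulg1.
  by apply: TV; exact: sub_symmetrize.
- exact: subset_trans V5.
have : approximate_group (2 * (M3 * M1 * M2 * M4 * D ^+ j)) (setmulg V V).
  apply: approximate_group_covering => //.
  - exact: open_symmetric_nbhd.
  - exact: setinvg_symmetric_nbhd.
  - apply: (@precompact_subset _ _ (cball r4)); first exact: subset_trans V5.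
    rewrite precompact_closed; first exact: (@lr_closed_ball _ _ _ hG).
    apply: compact_closed; first exact: metric_hausdorff.
    exact: (@lr_closed_ball _ _ _ hG).
  move=> s us sV sdis.
  have [t [[ut st] tA tM]] := hM4 eps A er Ar.
  have t0 : 0 < (size t)%:R :> R.
    by rewrite -(pmulr_rgt0 _ M40); apply: lt_le_trans tM.
  (* The products [x * a], with [a] in an [eps]-separated subset [t] of [A], are
     [L^-1 * eps]-separated in [V^5]. So [size s * size t] is bounded by the entropy of [V^5], while
     [size t] is comparable to that of [A]. *)
  have key : (size [seq (x, a) | x <- s, a <- t])%:R <=
      M3 * entropy (1 * eps) (setexpg V 5).
    apply: (hM3 eps _ _ _ (fun xa => (xa.1 * xa.2)%g)) => //.
    - by apply: allpairs_uniq => // -[? ?] [? ?].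
    - move=> _ /allpairsP[[x a] /= [/sV xV /tA /(@sub_symmetrize _ _ _) /TV Va ->]] /=.
      rewrite (setexpgD V 4 1) setexpg1.
      by exists x => //; exists a.
    move=> _ _ /allpairsP[[x a] /= [xs ta ->]] /allpairsP[[y d] /= [ys td ->]] /=.
    have Va : V a by apply: TV; apply: sub_symmetrize; exact: tA.
    have Vd : V d by apply: TV; apply: sub_symmetrize; exact: tA.
    have V5m z w : setexpg V 4 z -> V w -> setexpg V 5 (z * w)%g.
      by move=> Vz Vw; rewrite (setexpgD V 4 1) setexpg1; exists z => //; exists w.
    have V5V z : setexpg V 4 z -> setexpg V 5 (z^-1)%g.
      move=> Vz; apply: (sub 4) => //.
      rewrite -(setinvg_setexpg 4 (setinvg_symmetric_nbhd eps T)).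
      by exists z.
    have [+ _ _] := lip _ _ _ (V5 _ (V5m _ _ (sV x xs) Va))
      (V5 _ (V5m _ _ (sV y ys) Vd)) (V5 _ (V5V _ (sV x xs))).
    rewrite mulKg => le_ad near_xy.
    have ad : mdist a (x^-1 * (y * d))%g < eps.
      by apply: le_lt_trans le_ad _; rewrite mulrC -ltr_pdivlMr// mulrC.
    (* As [x^-1 y d] is within [eps] of [a], it lies in [V]; thus [y d] belongs to both [x V] and
       [y V]. *)
    have xy : x = y.
      apply: sdis => //; exists (y * d)%g; split; last by exists y => //; exists d.
      exists x => //; exists (x^-1 * (y * d))%g; last by rewrite mulVKg.
      apply: (@ball_symmetric_nbhd _ _ a); last by rewrite ballEmdist.
      by apply: sub_symmetrize; exact: tA.
    rewrite -xy in ad *; congr (_, _); apply: st => //.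
    by move: ad; rewrite mulKg mul1r.
  rewrite size_allpairs natrM mul1r in key.
  rewrite -(ler_pM2r t0); apply: le_trans key _.
  apply: (@le_trans _ _ (M3 * (M1 * M2 * D ^+ j * (M4 * (size t)%:R)))).
    rewrite ler_pM2l//; apply: le_trans entV _.
    by rewrite ler_pM2l// !mulr_gt0.
  by rewrite le_eqVlt; apply/orP; left; apply/eqP; ring.
move=> [? ? [X [? ? cX ?]]]; split=> //; exists X; split=> //.
by apply: le_trans cX _; rewrite mulrA ler_pM2r// lerDr ltW// mulr_gt0.
Qed.

End approximate_group_construction.

(** * Products contained in approximate groups *)

Section signed_product_bounds.
Context {R : realType} {G : metricGroupType R}.
Context {mu : {measure set (borel G) -> \bar R}}.
Hypothesis hG : locally_reasonable_metric_group mu.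
Implicit Types (A H X Y : set G) (r rho eps L : R).

Lemma entropy_translates r rho : exists2 M, 0 < M & forall eps (s : seq G) Y,
  0 < eps < rho -> {in s, forall x, cball r x} -> Y `<=` cball r ->
  entropy eps (setmulg [set` s] Y) <= (size s)%:R * (M * entropy eps Y).
Proof.
have [a ra ha] := setmulg_cball hG `|r|; have [b ab hb] := setmulg_cball hG a.
have [M M0 MP] := entropy_translate hG b rho; exists M => //.
have sub : (cball r : set G) `<=` cball `|r| by apply: le_cball; exact: ler_norm.
have sub1 : (cball `|r| : set G) `<=` cball a by exact: le_cball.
have sub2 : (cball a : set G) `<=` cball b by exact: le_cball.
move=> eps s Y er + Yr; have [e0 _] := andP er.
elim: s => [|x s IH] sr.
  rewrite mul0r; apply: (@entropy_le_size _ _ _ [::]).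
  by move=> ? [?].
have xr : cball r x by apply: sr; rewrite mem_head.
have sr' : {in s, forall x, cball r x} by move=> y ys; apply: sr; rewrite inE ys orbT.
have xYa : setmulg [set x] Y `<=` cball a.
  apply: (ha [set x] Y _ _).1; last exact: subset_trans sub.
  by move=> _ ->; exact: sub.
have sYa : setmulg [set` s] Y `<=` cball a.
  apply: (ha [set` s] Y _ _).1; last exact: subset_trans sub.
  by move=> y /= ys; apply: sub; exact: sr'.
have xV : cball b (x^-1)%g.
  apply: sub2; apply: (ha [set x] [set x] _ _).2; last by exists x.
    by move=> _ ->; exact: sub.
  by move=> _ ->; exact: sub.
have -> : setmulg [set` x :: s] Y = setmulg [set x] Y `|` setmulg [set` s] Y.
  rewrite -setmulgUl; congr setmulg; apply/seteqP; split=> y /=; rewrite inE.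
    by move=> /orP[/eqP|]; [left|right].
  by move=> [->|ys]; rewrite ?eqxx// [_ \in s]ys orbT.
apply: le_trans (entropyU hG e0 xYa sYa) _.
rewrite /= -natr1 mulrDl mul1r addrC lerD ?IH//.
apply: (MP eps _ _ (x^-1)%g 1%g) => //.
- by apply: sub2; apply: sub1; exact: cball1.
- exact: subset_trans sub2.
- by apply: subset_trans Yr _; apply: subset_trans sub _; apply: subset_trans sub2.
- by move=> _ [_ -> [y Yy <-]]; rewrite mulg1 mulKg.
Qed.

Lemma entropy_setexpg_approximate_group r rho n : exists2 M, 0 < M &
  forall eps L H, 0 < eps < rho -> H `<=` cball r -> approximate_group L H ->
    entropy eps (setexpg H n.+1) <= M * L ^+ n * entropy eps H.
Proof.
elim: n => [|n [M M0 MP]].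
  by exists 1 => // eps L H _ _ _; rewrite setexpg1 expr0 !mul1r.
have [a ha] := setexpg_cball hG r n.+1; have [b hb] := setexpg_cball hG r 2.
have [c hc] := setexpg_cball hG (Num.max a b) 2.
have [N N0 NP] := entropy_translates (Num.max a b) rho.
exists (N * M); first exact: mulr_gt0.
move=> eps L H er Hr HL; have [e0 _] := andP er.
have [_ _ [X [_ XHH XL HHX]]] := HL.
have HH : setexpg H 2 = setmulg H H by rewrite !setexpgS setmulg1.
have Xr : [set` X] `<=` cball (Num.max a b).
  apply: subset_trans XHH _; rewrite -HH; apply: subset_trans (hb _ Hr) _.
  by apply: le_cball; rewrite le_max lexx orbT.
have Hn : setexpg H n.+1 `<=` cball (Num.max a b).
  by apply: subset_trans (ha _ Hr) _; apply: le_cball; rewrite le_max lexx.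
have sub : setexpg H n.+2 `<=` setmulg [set` X] (setexpg H n.+1).
  by rewrite 2!setexpgS !setmulgA; apply: setmulgS.
have XHr : setmulg [set` X] (setexpg H n.+1) `<=` cball c.
  apply: subset_trans (hc ([set` X] `|` setexpg H n.+1) _).
    rewrite !setexpgS setmulg1.
    by apply: setmulgS => x; [left|right].
  by rewrite subUset.
apply: le_trans (le_entropy hG e0 XHr sub) _.
apply: le_trans (NP eps (enum_fset X) _ er Xr Hn) _.
have HR := MP eps L H er Hr HL.
have H0 : 0 <= entropy eps (setexpg H n.+1) by exact: (entropy_ge0 hG e0 Hn).
apply: (@le_trans _ _ (L * (N * entropy eps (setexpg H n.+1)))).
  by rewrite ler_wpM2r// mulr_ge0// ltW.
have L0 : 0 <= L by apply: le_trans XL.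
apply: (@le_trans _ _ (L * (N * (M * L ^+ n * entropy eps H)))).
  by rewrite ler_wpM2l// ler_pM2l.
by rewrite exprS le_eqVlt; apply/orP; left; apply/eqP; ring.
Qed.

Lemma signed_productS n (s : 'I_n.+1 -> bool) A : signed_product s A =
  setmulg (setsigng (s ord0) A) (signed_product (fun i => s (lift ord0 i)) A).
Proof. by rewrite /signed_product big_ord_recl. Qed.

Lemma signed_product_neq0 n (s : 'I_n -> bool) A : A !=set0 ->
  signed_product s A !=set0.
Proof.
move=> [x Ax]; elim: n s => [|n IH] s.
  by exists 1%g; rewrite /signed_product big_ord0.
rewrite signed_productS; have [y Ay] := IH (fun i => s (lift ord0 i)).
have [z Az] : setsigng (s ord0) A !=set0.
  by rewrite /setsigng; case: (s _); [exists (x^-1)%g; exists x|exists x].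
by exists (z * y)%g; exists z => //; exists y.
Qed.

Lemma signed_product_subset n (s : 'I_n -> bool) A H : setinvg H = H ->
  A `<=` H -> signed_product s A `<=` setexpg H n.
Proof.
move=> Hsym AH; elim: n s => [|n IH] s; first by rewrite /signed_product big_ord0.
rewrite signed_productS setexpgS; apply: setmulgS; last exact: IH.
by rewrite /setsigng; case: (s _) => //; rewrite -Hsym; exact: setinvgS.
Qed.

Lemma signed_product_cball r n : exists r', forall A (s : 'I_n -> bool),
  A `<=` cball r -> signed_product s A `<=` cball r'.
Proof.
have [r1 hT] := bounded_symmetrize hG (r := r).
have [r2 h2] := setexpg_cball hG r1 n; exists r2 => A s Ar.
apply: subset_trans (h2 _ (hT A Ar)); apply: signed_product_subset.
  exact: setinvg_symmetrize.
exact: sub_symmetrize.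
Qed.

(** A point [g] of the product of the remaining factors translates [A] or [A^-1] into the whole
    product; the two summands of the constant serve the two signs. *)
Lemma entropy_le_signed_product r rho n : (0 < n)%N -> exists2 M, 0 < M &
  forall eps A (s : 'I_n -> bool), 0 < eps < rho -> A `<=` cball r ->
    A !=set0 -> entropy eps A <= M * entropy eps (signed_product s A).
Proof.
case: n => // n _.
have [a ha] := signed_product_cball r n; have [b hb] := signed_product_cball r n.+1.
have [c rc hc] := setmulg_cball hG r.
pose m := Num.max `|a| (Num.max b c).
have ma : (cball a : set G) `<=` cball m.
  by apply: le_cball; rewrite le_max ler_norm.
have mb : (cball b : set G) `<=` cball m.
  by apply: le_cball; rewrite !le_max lexx orbT.
have mc : (cball c : set G) `<=` cball m.
  by apply: le_cball; rewrite !le_max lexx !orbT.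
have m0 : cball m (1%g : G) by apply: cball1; rewrite le_max normr_ge0.
have [M M0 MP] := entropy_translate hG m rho.
have [N N0 NP] := entropy_inv hG m rho.
exists (M + N * M); first by rewrite addr_gt0 ?mulr_gt0.
move=> eps A s er Ar A0; have [e0 _] := andP er.
have [g Ag] := signed_product_neq0 (fun i => s (lift ord0 i)) A0.
have Am : A `<=` cball m.
  by apply: subset_trans Ar _; apply: subset_trans mc; exact: le_cball.
have Vm : setinvg A `<=` cball m by apply: subset_trans mc; exact: (hc A A Ar Ar).2.
have Pm : signed_product s A `<=` cball m by apply: subset_trans mb; exact: hb.
have gm : cball m g by apply: ma; exact: ha Ag.
have P0 : 0 <= entropy eps (signed_product s A) by exact: (entropy_ge0 hG e0 Pm).
have shift : entropy eps (setsigng (s ord0) A) <= M * entropy eps (signed_product s A).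
  apply: (MP eps _ _ 1%g g) => //.
    by rewrite /setsigng; case: (s _).
  by move=> x Ax; rewrite mul1g signed_productS; exists x => //; exists g.
move: shift; rewrite /setsigng; case: (s ord0) => h.
  apply: le_trans (NP eps A (setinvg A) er Am Vm (@subset_refl _ _)) _.
  apply: (@le_trans _ _ (N * (M * entropy eps (signed_product s A)))).
    by rewrite ler_pM2l.
  by rewrite mulrA ler_wpM2r// lerDr ltW.
by apply: le_trans h _; rewrite ler_wpM2r// lerDl mulr_ge0// ltW.
Qed.

End signed_product_bounds.

(** * Implied constants *)

Section implied_constants.
Context {R : realType}.
Implicit Types (c C K M : R).

(* The constant [C] may be enlarged, so that finitely many bounds can share
   their constant. *)
Lemma power_absorption M c j : 0 < M -> 0 < c -> exists2 C, 0 < C &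
  forall C' K, C <= C' -> 1 <= K -> M * ((1 + c) * K `^ c) ^+ j <= C' * K `^ C'.
Proof.
move=> M0 c0; have c1 : 0 < 1 + c by rewrite addr_gt0.
exists (M * (1 + c) ^+ j + c *+ j).
  by rewrite ltr_pwDl ?mulrn_wge0 ?(ltW c0)// mulr_gt0// exprn_gt0.
move=> C' K CC K1; rewrite exprMn mulrA.
have h : 0 < M * (1 + c) ^+ j by rewrite mulr_gt0// exprn_gt0.
have h2 : 0 <= c *+ j by rewrite mulrn_wge0// ltW.
apply: ler_pM; first exact: ltW.
- by rewrite exprn_ge0// powR_ge0.
- by apply: le_trans CC; rewrite lerDl.
rewrite -powR_mulrn ?powR_ge0// -powRrM; apply: ler_powR => //.
by rewrite mulr_natr; apply: le_trans CC; rewrite lerDr ltW.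
Qed.

Lemma power_ge1 c K : 0 < c -> 1 <= K -> 1 <= (1 + c) * K `^ c.
Proof.
move=> c0 K1; rewrite -[leLHS]mulr1; apply: ler_pM => //.
  by rewrite lerDl ltW.
by rewrite -[leLHS](powRr0 K); apply: ler_powR => //; exact: ltW.
Qed.

Lemma le_power c K : 0 < c -> 1 <= K -> c * K `^ c <= (1 + c) * K `^ c.
Proof. by move=> c0 K1; rewrite ler_wpM2r ?powR_ge0// lerDr. Qed.

End implied_constants.

Section polynomial_bounds.
Context {R : realType} {G : metricGroupType R}.
Context {mu : {measure set (borel G) -> \bar R}}.
Hypothesis hG : locally_reasonable_metric_group mu.
Implicit Types (A X Y : set G) (r rho eps C K : R).

Lemma poly_lesssimE r C K eps X Y : 0 < eps -> X `<=` cball r -> Y `<=` cball r ->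
  poly_lesssim C K (metric_entropy eps X) (metric_entropy eps Y) <->
  entropy eps X <= C * K `^ C * entropy eps Y.
Proof.
move=> e0 Xr Yr; rewrite /poly_lesssim (entropyE hG e0 Xr) (entropyE hG e0 Yr).
by rewrite -EFinM lee_fin.
Qed.

Lemma poly_simE r C K eps X Y : 0 < C -> 1 <= K -> 0 < eps ->
  X `<=` cball r -> Y `<=` cball r ->
  poly_sim C K (metric_entropy eps X) (metric_entropy eps Y) <->
  entropy eps Y <= C * K `^ C * entropy eps X /\
  entropy eps X <= C * K `^ C * entropy eps Y.
Proof.
move=> C0 K1 e0 Xr Yr; rewrite /poly_sim (entropyE hG e0 Xr) (entropyE hG e0 Yr).
rewrite -!EFinM !lee_fin powRN -invfM ler_pdivrMl.
  by split=> [/andP[]|[? ?]]//; apply/andP.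
by rewrite mulr_gt0// powR_gt0// (lt_le_trans ltr01).
Qed.

Lemma uniformly_implies_trans (Kc : set G) rho (I J L : Type)
    (P : I -> R -> R -> set G -> Prop) (Q : J -> R -> R -> set G -> Prop)
    (S : L -> R -> R -> set G -> Prop) :
  uniformly_implies Kc rho P Q -> uniformly_implies Kc rho Q S ->
  uniformly_implies Kc rho P S.
Proof.
move=> PQ QS c; have [c' h] := PQ c; have [c'' h'] := QS c'.
by exists c'' => eps K A e0 K1 AK A0 /h /h'; apply.
Qed.

(** The implied constant [c] may be less than 1 whereas [tripling] asks for [1 <= D]; hence
    [1 + c]. *)
Lemma tripling_of_small_tripling r rho (c : {posnum R}) eps K A :
  0 < eps < rho -> 1 <= K -> A `<=` cball r -> A !=set0 ->
  small_tripling c eps K A ->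
  @tripling _ _ r rho eps A ((1 + c%:num) * K `^ c%:num).
Proof.
move=> er K1 Ar A0; have [e0 _] := andP er.
have [a ha] := bounded_setmulg hG (bounded_setmulg hG (@bounded_id _ _ r)
  (@bounded_id _ _ r)) (@bounded_id _ _ r).
have Aa : A `<=` cball (Num.max a r).
  by apply: subset_trans Ar _; apply: le_cball; rewrite le_max lexx orbT.
have A3a : setmulg (setmulg A A) A `<=` cball (Num.max a r).
  by apply: subset_trans (ha A Ar) _; apply: le_cball; rewrite le_max lexx.
move=> /(poly_lesssimE _ _ e0 A3a Aa) h; split=> //; first exact: power_ge1.
apply: le_trans h _; rewrite ler_wpM2r ?le_power//.
exact: (entropy_ge0 hG e0 Ar).
Qed.

(** Only upper bounds need to be supplied: the lower half of [poly_sim] holds whatever [P] is. They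
    are required for all [C' >= C] so that one constant can serve both halves. *)
Lemma small_products_of_bounds r rho (Kc : set G) (I : Type)
    (P : I -> R -> R -> set G -> Prop) : Kc `<=` cball r ->
  (forall c n, (0 < n)%N -> exists2 C, 0 < C & forall C' eps K A (s : 'I_n -> bool),
    C <= C' -> 0 < eps < rho -> 1 <= K -> A `<=` Kc -> A !=set0 ->
    P c eps K A ->
    entropy eps (signed_product s A) <= C' * K `^ C' * entropy eps A) ->
  uniformly_implies Kc rho P small_products.
Proof.
move=> Kr hP c.
pose Q n (C : {posnum R}) := forall eps K A (s : 'I_n -> bool),
  0 < eps < rho -> 1 <= K -> A `<=` Kc -> A !=set0 -> P c eps K A ->
  entropy eps A <= C%:num * K `^ C%:num * entropy eps (signed_product s A) /\
  entropy eps (signed_product s A) <= C%:num * K `^ C%:num * entropy eps A.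
have [C CP] : {C : nat -> {posnum R} & forall n, (0 < n)%N -> Q n (C n)}.
  apply: (@choice _ _ (fun n (C : {posnum R}) => (0 < n)%N -> Q n C)) => n.
  (* The empty product is excluded from [small_products], so its constant is a mere default. *)
  have [->|n0] := posnP n; first by exists 1%:pos.
  have [C C0 CP] := hP c n n0.
  have [M M0 MP] := entropy_le_signed_product hG r rho n0.
  have CM0 : 0 < C + M by rewrite addr_gt0.
  exists (PosNum CM0) => _ eps K A s er K1 AK A0 h /=.
  have [e0 _] := andP er; have Ar := subset_trans AK Kr.
  split; last by apply: CP => //; rewrite lerDl ltW.
  apply: le_trans (MP eps A s er Ar A0) _.
  have [b hb] := signed_product_cball hG r n.
  rewrite ler_wpM2r ?(entropy_ge0 hG e0 (hb A s Ar))//.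
  rewrite -[leLHS]mulr1; apply: ler_pM => //; first exact: ltW.
    by rewrite lerDr ltW.
  by rewrite -[leLHS](powRr0 K); apply: ler_powR => //; exact: ltW.
exists C => eps K A er K1 AK A0 h n n1 s; have [e0 _] := andP er.
have Ar := subset_trans AK Kr; have [b hb] := signed_product_cball hG r n.
apply/(@poly_simE (Num.max r b)) => //.
- by apply: subset_trans (hb A s Ar) _; apply: le_cball; rewrite le_max lexx orbT.
- by apply: subset_trans Ar _; apply: le_cball; rewrite le_max lexx.
- exact: CP.
Qed.

Lemma small_products_of_tripling (Kc : set G) rho : compact Kc ->
  uniformly_implies Kc rho small_tripling small_products.
Proof.
move=> /compact_sub_cball [r Kr]; apply: (small_products_of_bounds Kr) => c n n0.
have [M [j [M0 MP]]] := controlled_symmetrize hG (r := r) (rho := rho) n.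
have c0 : 0 < c%:num by [].
have [C C0 CP] := power_absorption j M0 c0.
exists C => // C' eps K A s CC er K1 AK A0 h.
have [e0 _] := andP er; have Ar := subset_trans AK Kr.
have T := tripling_of_small_tripling er K1 Ar A0 h.
have [r1 hT] := bounded_symmetrize hG (r := r).
have [r2 h2] := setexpg_cball hG r1 n.
have sT := signed_product_subset (s := s) (setinvg_symmetrize A) (@sub_symmetrize _ _ A).
apply: le_trans (le_entropy hG e0 (h2 _ (hT A Ar)) sT) _.
apply: le_trans (MP eps A _ T) _.
by rewrite ler_wpM2r ?CP// (entropy_ge0 hG e0 Ar).
Qed.

Lemma small_tripling_of_products (Kc : set G) rho :
  uniformly_implies Kc rho small_products small_tripling.
Proof.
move=> c; exists (c 3) => eps K A _ _ _ _ /(_ 3 isT (fun=> false)).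
by rewrite signed_product_cube => /andP[].
Qed.

Lemma approximate_group_control_of_tripling (Kc : set G) rho : compact Kc ->
  exists2 Kt : set G, compact Kt &
    uniformly_implies Kc rho small_tripling (approximate_group_control Kt).
Proof.
move=> /compact_sub_cball [r Kr].
have [r' [M [j [M0 MP]]]] := approximate_group_of_tripling hG r rho.
(* [r'] is obtained before [c] is introduced, so this compact set does not depend on the implied
   constants. *)
exists (cball r'); first exact: (@lr_closed_ball _ _ _ hG).
move=> c; have c0 : 0 < c%:num by [].
have [C C0 CP] := power_absorption j M0 c0.
(* A constant at least 1, as needed to weaken the entropy bound for [A] inside [H] to the form of
   [poly_sim]. *)
have C10 : 0 < C + 1 by rewrite addr_gt0.
exists (PosNum C10) => eps K A er K1 AK A0 h /=.
have [e0 _] := andP er; have Ar := subset_trans AK Kr.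
have T := tripling_of_small_tripling er K1 Ar A0 h.
have [H [Happ He AH Hr]] := MP eps A _ T.
have CC : C <= C + 1 by rewrite lerDl.
exists H; split=> //.
  have [? ? [X [? ? XM ?]]] := Happ; split=> //; exists X; split=> //.
  by apply: le_trans XM _; exact: CP.
apply/(poly_simE C10 K1 e0 Hr (subset_trans AH Hr)).
have HA := le_entropy hG e0 Hr AH.
have E0 := entropy_ge0 hG e0 Hr; have A0' := entropy_ge0 hG e0 Ar.
split.
  apply: le_trans HA _; rewrite -[leLHS]mul1r ler_wpM2r//.
  rewrite -[leLHS]mulr1; apply: ler_pM => //; first by rewrite lerDr ltW.
  by rewrite -[leLHS](powRr0 K); apply: ler_powR => //; exact: (ltW C10).
by apply: le_trans He _; rewrite ler_wpM2r// CP.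
Qed.

Lemma small_products_of_approximate_group_control (Kc Kt : set G) rho :
  compact Kc -> compact Kt ->
  uniformly_implies Kc rho (approximate_group_control Kt) small_products.
Proof.
move=> /compact_sub_cball [r Kr] /compact_sub_cball [r' Kr'].
apply: (small_products_of_bounds Kr) => c [//|n] _.
have [M M0 MP] := entropy_setexpg_approximate_group hG r' rho n.
have c0 : 0 < c%:num by [].
(* There are [n] powers from covering [H^(n+1)] by translates of [H], and one more from comparing
   [H] with [A]. *)
have [C C0 CP] := power_absorption n.+1 M0 c0.
exists C => // C' eps K A s CC er K1 AK A0 [H [Happ Hsim AH HK]].
have [e0 _] := andP er; have Ar := subset_trans AK Kr.
have Hr := subset_trans HK Kr'.
move: Hsim => /(poly_simE c0 K1 e0 Hr (subset_trans AH Hr)) [_ HA].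
have [b hb] := setexpg_cball hG r' n.+1.
have [_ Hsym _] := Happ.
apply: le_trans (le_entropy hG e0 (hb H Hr) (signed_product_subset Hsym AH (s := s))) _.
apply: le_trans (MP eps _ H er Hr Happ) _.
have k0 : 0 <= c%:num * K `^ c%:num by rewrite mulr_ge0// powR_ge0.
have A0' := entropy_ge0 hG e0 Ar.
apply: (@le_trans _ _ (M * (c%:num * K `^ c%:num) ^+ n.+1 * entropy eps A)).
  apply: le_trans (ler_wpM2l _ HA) _; first by rewrite mulr_ge0 ?exprn_ge0// ltW.
  by rewrite exprSr !mulrA.
rewrite ler_wpM2r//; apply: le_trans (CP C' K CC K1).
rewrite ler_pM2l//; apply: lerXn2r; rewrite ?nnegrE ?le_power//.
exact: le_trans ler01 (power_ge1 c0 K1).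
Qed.

End polynomial_bounds.

Theorem theorem6p8 (R : realType) (G : metricGroupType R)
    (mu : {measure set (borel G) -> \bar R})
    (hG : locally_reasonable_metric_group mu)
    (Kc : set G) (hKc : compact Kc) (rho : R) (hrho : 0 < rho) :
  exists2 Kt : set G, compact Kt &
    [/\ uniformly_implies Kc rho small_tripling small_products,
        uniformly_implies Kc rho small_tripling (approximate_group_control Kt),
        uniformly_implies Kc rho small_products small_tripling,
        uniformly_implies Kc rho small_products (approximate_group_control Kt) &
        forall Kt' : set G, compact Kt' ->
          uniformly_implies Kc rho (approximate_group_control Kt') small_tripling
          /\ uniformly_implies Kc rho (approximate_group_control Kt')
               small_products].
Proof.
have [Kt cKt tripling_group] := approximate_group_control_of_tripling hG rho hKc.
have products := small_products_of_tripling hG rho hKc.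
exists Kt => //; split=> //.
- exact: small_tripling_of_products.
- exact: uniformly_implies_trans (small_tripling_of_products _ _) tripling_group.
move=> Kt' cKt'.
have group_products := small_products_of_approximate_group_control hG rho hKc cKt'.
split=> //.
exact: uniformly_implies_trans group_products (small_tripling_of_products _ _).
Qed.
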